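(* Consider the constrained convex problem and the sequential random minibatch subgradient algorithm described in the context, under Assumption A (a), (b), (c) and Assumption B stated there. Let the stepsizes be $\beta\in(0,2)$ and $\alpha_k=\frac{4}{\mu(k+1)}$ for $k\ge0$. Let also $q:=\frac{\beta(2-\beta)}{cM_g^2}<1$ and $b_N^s:=(1-q)^{-N}-1$. Then the averaged sequence $$\hat x_t=\sum_{k=1}^t\frac{(k+1)^2}{S_t}\,x_k,\qquad S_t=\sum_{k=1}^t(k+1)^2,\qquad t\ge1,$$ generated by the algorithm satisfies $$\mathsf{E}\big[|f(\hat x_t)-f^*|\big]\le\mathcal{O}\left(\frac1t+\frac{1}{\sqrt{b_N^s}\,t}\right),\qquad \mathsf{E}\big[\mathrm{dist}(\hat x_t,X)\big]\le\mathcal{O}\left(\frac{1}{\sqrt{b_N^s}\,t}\right),$$ where, for functions of $t$, $h_1(t)\le\mathcal{O}(h_2(t))$ means that there exist $C>0$ and $t_0$ such that $h_1(t)\le C\,h_2(t)$ for all $t\ge t_0$.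
   Context: Notation: $\|\cdot\|$ is the Euclidean norm on $\mathbb{R}^n$, $a^+=\max\{a,0\}$, $\Pi_Z$ is the Euclidean projection onto a closed convex set $Z$, $\mathrm{dist}(x,Z)=\min_{z\in Z}\|x-z\|$, $\partial h(x)$ is the subdifferential of a convex function $h$ at $x$, $s_f(x)$ denotes a subgradient of $f$ at $x$, and $g_\omega^+(x)=\max\{g_\omega(x),0\}$. Problem: minimize $f(x)$ subject to $x\in X:=Y\cap\left(\bigcap_{\omega\in\mathcal{A}}X_\omega\right)$, where $X_\omega=\{x\in\mathbb{R}^n: g_\omega(x)\le 0\}$ and $\mathcal{A}$ is an arbitrary (possibly infinite) index set. The functions $f$ and $g_\omega$ are convex with values in the extended reals, and their domains contain $Y$. The optimal value $f^*=\inf_{x\in X}f(x)$ is finite, and $X^*=\{x\in X: f(x)=f^*\}$. Assumption A. (a) $Y$ is closed and convex; $X$ and $X^*$ are nonempty. (b) $f$ is strongly convex on $Y$ with constant $\mu>0$: $f(y)\ge f(x)+\langle s,y-x\rangle+\frac{\mu}{2}\|y-x\|^2$ for all $x,y\in Y$ and $s\in\partial f(x)$; and there is $M_f>0$ with $\|s\|\le M_f$ for all $s\in\partial f(x)$, $x\in Y$. (c) There is $M_g>0$ such that $\|d\|\le M_g$ for all $d\in\partial g_\omega(x)$, $x\in Y$, $\omega\in\mathcal{A}$. Sequential algorithm: $x_0\in Y$ is random with an arbitrary distribution, $N\ge1$ is the minibatch size, $\alpha_k>0$ and $\beta>0$ are deterministic stepsizes. For $k\ge1$, draw random indices $\omega_k^1,\dots,\omega_k^N\in\mathcal{A}$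 according to a probability distribution $\mathbf{P}$ and set $$v_k=\Pi_Y[x_{k-1}-\alpha_{k-1}s_f(x_{k-1})],$$ $$z_k^0=v_k,\qquad z_k^i=\Pi_Y\left[z_k^{i-1}-\beta\,\frac{g^+_{\omega_k^i}(z_k^{i-1})}{\|d_k^i\|^2}\,d_k^i\right]\quad(i=1,\dots,N),\qquad x_k=z_k^N,$$ where $d_k^i\in\partial g^+_{\omega_k^i}(z_k^{i-1})$ if $g^+_{\omega_k^i}(z_k^{i-1})>0$, and $d_k^i=d$ for some arbitrary $d\ne0$ if $g^+_{\omega_k^i}(z_k^{i-1})=0$. $\mathcal{F}_k$ denotes the sigma-field generated by $x_0$ and $\{\omega_t^j: 1\le t\le k,\ 1\le j\le N\}$; $\mathcal{F}_0$ is generated by $x_0$. Assumption B. There is a constant $c\in(0,\infty)$ such that $\mathrm{dist}^2(y,X)\le c\,\mathsf{E}\big[(g^+_{\omega_k^i}(y))^2\mid\mathcal{F}_{k-1}\big]$ for all $y\in Y$, $k\ge1$, $i=1,\dots,N$. *)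

(* Defs.v *)
From HB Require Import structures.
From mathcomp Require Import all_boot all_order all_algebra.
From mathcomp Require Import all_classical all_reals all_analysis.
From mathcomp Require Import measurable_realfun.

Set Implicit Arguments.
Unset Strict Implicit.
Unset Printing Implicit Defensive.

Import Order.TTheory GRing.Theory Num.Theory.
Import numFieldNormedType.Exports.

Local Open Scope classical_set_scope.
Local Open Scope ring_scope.

Section Euclidean.
Context {R : realType} {n : nat}.
Implicit Types (x y s : 'rV[R]_n) (Z : set 'rV[R]_n).

Definition dotv x y : R := \sum_(j < n) x 0 j * y 0 j.

(* The library norm `|x| on row vectors is the sup norm, hence this one.  The
   library topology on 'rV[R]_n is the usual one, so [closed] needs no change. *)
Definition enorm x : R := Num.sqrt (dotv x x).

Definition dist x Z : R := inf [set enorm (x - z) | z in Z].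

(* The default value x of [xget] is never used when Z is closed, convex and
   nonempty: the nearest point then exists and is unique. *)
Definition proj Z x : 'rV[R]_n :=
  xget x [set p | Z p /\ forall z, Z z -> enorm (x - p) <= enorm (x - z)].

Implicit Types (h : 'rV[R]_n -> \bar R).

Definition edom h : set 'rV[R]_n := [set x | (h x < +oo)%E].

Definition convex_efun h : Prop :=
  convex_set ([set p | (h p.1 <= p.2%:E)%E]
    : set (convex_lmodType ('rV[R]_n * R^o)%type)).

Definition subdiff h x : set 'rV[R]_n :=
  [set s | forall y, (h x + (dotv s (y - x))%:E <= h y)%E].

Definition epos h : 'rV[R]_n -> \bar R := fun x => maxe (h x) 0%E.

End Euclidean.

Definition feasible {R : realType} {n : nat} {A : Type} (Y : set 'rV[R]_n)
    (g : A -> 'rV[R]_n -> \bar R) : set 'rV[R]_n :=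
  [set x | Y x /\ forall a, (g a x <= 0)%E].

(* Measurability of a random vector for a sigma-field G.  The library has no
   Borel structure on 'rV[R]_n; Borel measurability of a map into R^n is the
   same as measurability of its coordinates. *)
Definition vmeasurable {R : realType} {n : nat} {T : Type} (G : set (set T))
    (u : T -> 'rV[R]_n) : Prop :=
  forall (j : 'I_n) (B : set R), measurable B -> G ((fun w => u w 0 j) @^-1` B).

(* Z is a version of E[U | G], for U nonnegative and G a sub-sigma-field. *)
Definition is_cond_exp {R : realType} {d} {T : measurableType d}
    (P : probability T R) (G : set (set T)) (U Z : T -> \bar R) : Prop :=
  [/\ forall w, (0 <= Z w)%E,
      forall B : set (\bar R), measurable B -> G (Z @^-1` B)
    & forall D, G D ->
        (\int[P]_(w in D) Z w)%E = (\int[P]_(w in D) U w)%E].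

(* The sigma-field F_k generated by x0 and the om t j, 1 <= t <= k, 1 <= j <= N. *)
Definition history {R : realType} {n : nat} {T : Type} {d} {A : measurableType d}
    (x0 : T -> 'rV[R]_n) (om : nat -> nat -> T -> A) (N k : nat) : set (set T) :=
  <<s [set D | exists (j : 'I_n) (B : set R),
         measurable B /\ D = (fun w => x0 w 0 j) @^-1` B]
      `|` [set D | exists (t j : nat) (B : set A),
         [/\ (1 <= t <= k)%N, (1 <= j <= N)%N, measurable B
           & D = om t j @^-1` B]] >>.

(* (x, v, z, d) are the iterates and feasibility directions of the sequential
   algorithm with objective subgradients sf, started at x 0 and driven by the
   indices om.  Adaptedness says that the choices of subgradients do not look at
   indices that have not been drawn yet. *)
Record seq_run {R : realType} {n : nat} {T : Type} {dA} {A : measurableType dA}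
    (Y : set 'rV[R]_n) (sf : 'rV[R]_n -> 'rV[R]_n)
    (g : A -> 'rV[R]_n -> \bar R) (alpha : nat -> R) (beta : R) (N : nat)
    (om : nat -> nat -> T -> A) (x v : nat -> T -> 'rV[R]_n)
    (z d : nat -> nat -> T -> 'rV[R]_n) : Prop := SeqRun {
  run_init : forall w, Y (x 0%N w);
  run_grad : forall k w, (1 <= k)%N ->
    v k w = proj Y (x k.-1 w - alpha k.-1 *: sf (x k.-1 w));
  run_start : forall k w, (1 <= k)%N -> z k 0%N w = v k w;
  run_step : forall k i w, (1 <= k)%N -> (1 <= i <= N)%N ->
    z k i w = proj Y (z k i.-1 w
      - (beta * (fine (epos (g (om k i w)) (z k i.-1 w)) / enorm (d k i w) ^+ 2))
        *: d k i w);
  run_end : forall k w, (1 <= k)%N -> x k w = z k N w;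
  run_dir_pos : forall k i w, (1 <= k)%N -> (1 <= i <= N)%N ->
    (0 < epos (g (om k i w)) (z k i.-1 w))%E ->
    subdiff (epos (g (om k i w))) (z k i.-1 w) (d k i w);
  run_dir_zero : forall k i w, (1 <= k)%N -> (1 <= i <= N)%N ->
    epos (g (om k i w)) (z k i.-1 w) = 0%E -> d k i w != 0;
  run_adapted_v : forall k, (1 <= k)%N ->
    vmeasurable (history (x 0%N) om N k.-1) (v k);
  run_adapted_x : forall k, (1 <= k)%N ->
    vmeasurable (history (x 0%N) om N k) (x k) }.

Definition avg_weight (R : realType) (t : nat) : R :=
  \sum_(1 <= k < t.+1) (k.+1)%:R ^+ 2.

Definition average {R : realType} {n : nat} {T : Type}
    (x : nat -> T -> 'rV[R]_n) (t : nat) (w : T) : 'rV[R]_n :=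
  \sum_(1 <= k < t.+1) ((k.+1)%:R ^+ 2 / avg_weight R t) *: x k w.

Definition bigO_le {R : realType} (h1 : nat -> \bar R) (h2 : nat -> R) : Prop :=
  exists (C : R) (t0 : nat), 0 < C /\
    forall t, (t0 <= t)%N -> (h1 t <= (C * h2 t)%:E)%E.

(* Main.v *)
(* Strong convexity and bounded subgradients make Y bounded.  Along every sample
   path the projected gradient step contracts the squared distance to an optimal
   point p, and the feasibility steps do not increase the distance to any
   feasible point, so the one-step inequality multiplied by (k+1)^3 telescopes:
   f(x^_t) - f* <= C/t holds surely.  Since f is Mf-Lipschitz on Y, also
   f(x^_t) - f* >= - Mf dist(x^_t, X), and only the distance bound is random.
   For it, the first feasibility step of the minibatch decreases dist^2(., X) by a
   multiple of the squared violation of a constraint whose index is drawn after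
   v_k is known; the regularity assumption, applied at the random point v_k, gives
   E dist^2(x_k, X) <= (1 - q) E dist^2(v_k, X).  The gradient step adds at most
   4 Mf / (mu k) to the distance, hence E dist^2(x_k, X) = O(1/k^2), and both rates
   follow by averaging.  As b does not depend on t, neither the other N - 1 steps
   nor independence inside a minibatch matters. *)

From Pilot Require Import Defs.
From HB Require Import structures.
From mathcomp Require Import all_boot all_order all_algebra.
From mathcomp Require Import all_classical all_reals all_analysis.
From mathcomp Require Import measurable_realfun.
From mathcomp Require Import ring lra.
Import Order.TTheory GRing.Theory Num.Theory.
Import numFieldNormedType.Exports.
Set Implicit Arguments.
Unset Strict Implicit.
Unset Printing Implicit Defensive.

Local Open Scope classical_set_scope.
Local Open Scope ring_scope.

(* The library has another [proj]. *)
Local Notation proj := Pilot.Defs.proj.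

(** * Inner product, projection onto a closed convex set, distance to a set *)

Section EuclideanGeometry.
Context {R : realType} {n : nat}.
Implicit Types (x y z u p : 'rV[R]_n) (a r : R) (Z : set 'rV[R]_n).

Lemma dotvC x y : dotv x y = dotv y x.
Proof. by apply: eq_bigr => j _; rewrite mulrC. Qed.

Lemma dotvDl x y z : dotv (x + y) z = dotv x z + dotv y z.
Proof. by rewrite -big_split; apply: eq_bigr => j _; rewrite mxE mulrDl. Qed.

Lemma dotvZl a x y : dotv (a *: x) y = a * dotv x y.
Proof. by rewrite mulr_sumr; apply: eq_bigr => j _; rewrite mxE mulrA. Qed.

Lemma dotvNl x y : dotv (- x) y = - dotv x y.
Proof. by rewrite -scaleN1r dotvZl mulN1r. Qed.

Lemma dotv0l y : dotv 0 y = 0.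
Proof. by rewrite -(scale0r (0 : 'rV[R]_n)) dotvZl mul0r. Qed.

Lemma dotvDr x y z : dotv x (y + z) = dotv x y + dotv x z.
Proof. by rewrite dotvC dotvDl !(dotvC _ x). Qed.

Lemma dotvZr a x y : dotv x (a *: y) = a * dotv x y.
Proof. by rewrite dotvC dotvZl dotvC. Qed.

Lemma dotvNr x y : dotv x (- y) = - dotv x y.
Proof. by rewrite dotvC dotvNl dotvC. Qed.

Lemma dotv0r x : dotv x 0 = 0.
Proof. by rewrite dotvC dotv0l. Qed.

Definition dotvE := (dotvDl, dotvDr, dotvZl, dotvZr, dotvNl, dotvNr).

Lemma dotvv_ge0 x : 0 <= dotv x x.
Proof. by apply: sumr_ge0 => j _; rewrite -expr2 sqr_ge0. Qed.

Lemma enorm_ge0 x : 0 <= enorm x.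
Proof. exact: sqrtr_ge0. Qed.

Lemma enorm_sqr x : enorm x ^+ 2 = dotv x x.
Proof. exact/sqr_sqrtr/dotvv_ge0. Qed.

Lemma enormB_sqr x y :
  enorm (x - y) ^+ 2 = enorm x ^+ 2 - 2 * dotv x y + enorm y ^+ 2.
Proof. by rewrite !enorm_sqr !dotvE (dotvC y x); ring. Qed.

Lemma ler_coord_enorm x j : `|x 0 j| <= enorm x.
Proof.
rewrite -(ler_pXn2r (n := 2)) ?nnegrE ?enorm_ge0// enorm_sqr real_normK ?num_real//.
by rewrite /dotv (bigD1 j)//= -expr2 lerDl sumr_ge0// => i _; rewrite -expr2 sqr_ge0.
Qed.

Lemma enorm_eq0 x : enorm x = 0 -> x = 0.
Proof.
move=> x0; apply/rowP => j; rewrite mxE.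
by apply/eqP; rewrite -normr_le0 -x0 ler_coord_enorm.
Qed.

Lemma enorm0 : enorm (0 : 'rV[R]_n) = 0.
Proof. by rewrite /enorm dotv0l sqrtr0. Qed.

Lemma enormN x : enorm (- x) = enorm x.
Proof. by rewrite /enorm dotvNl dotvNr opprK. Qed.

Lemma enormB x y : enorm (x - y) = enorm (y - x).
Proof. by rewrite -enormN opprB. Qed.

Lemma enormZ a x : enorm (a *: x) = `|a| * enorm x.
Proof.
by rewrite /enorm dotvZl dotvZr mulrA -expr2 sqrtrM ?sqr_ge0// sqrtr_sqr.
Qed.

(** For nonzero [y], the squared norm of |y|^2 x - <x,y> y is nonnegative and equals |y|^2 (|x|^2
    |y|^2 - <x,y>^2). *)
Lemma cauchy_schwarz x y : `|dotv x y| <= enorm x * enorm y.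
Proof.
have [/enorm_eq0 ->|y0] := eqVneq (enorm y) 0; first by rewrite dotv0r enorm0 normr0 mulr0.
have yy : 0 < enorm y ^+ 2 by rewrite exprn_gt0// lt_neqAle eq_sym y0 enorm_ge0.
rewrite -(ler_pXn2r (n := 2)) ?nnegrE ?mulr_ge0 ?enorm_ge0// real_normK ?num_real// exprMn.
have := dotvv_ge0 (enorm y ^+ 2 *: x - dotv x y *: y).
rewrite !dotvE -!enorm_sqr (dotvC y x) => H.
rewrite -(ler_pM2l yy) -subr_ge0; apply: le_trans H _; rewrite le_eqVlt; apply/orP; left.
by apply/eqP; ring.
Qed.

Lemma dotv_le x y : dotv x y <= enorm x * enorm y.
Proof. exact: le_trans (ler_norm _) (cauchy_schwarz x y). Qed.

Lemma ler_enormD x y : enorm (x + y) <= enorm x + enorm y.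
Proof.
rewrite -(ler_pXn2r (n := 2)) ?nnegrE ?addr_ge0 ?enorm_ge0// enorm_sqr !dotvE.
rewrite -!enorm_sqr (dotvC y x).
by have := dotv_le x y; lra.
Qed.

Lemma enorm_le_sum x : enorm x <= \sum_(j < n) `|x 0 j|.
Proof.
have S0 : 0 <= \sum_(j < n) `|x 0 j| by exact: sumr_ge0.
rewrite -(ler_pXn2r (n := 2)) ?nnegrE ?enorm_ge0// enorm_sqr expr2 mulr_suml.
apply: ler_sum => j _; apply: le_trans (ler_norm _) _; rewrite normrM ler_wpM2l//.
by rewrite (bigD1 j)//= lerDl sumr_ge0.
Qed.

Lemma convex_setP Z :
  convex_set (Z : set (convex_lmodType 'rV[R]_n)) ->
  forall x y a, Z x -> Z y -> 0 <= a <= 1 -> Z (a *: x + (1 - a) *: y).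
Proof.
move=> cZ x y a Zx Zy /andP[a0 a1].
have := cZ x y (Itv01 a0 a1) (mem_set Zx) (mem_set Zy).
by rewrite inE.
Qed.

Lemma enormB_continuous x : continuous (fun z => enorm (x - z)).
Proof.
(* The sum over all coordinates is generalised to a sum over any list of indices, to allow induction
   on the list. *)
suff H (s : seq 'I_n) :
    continuous (fun z : 'rV[R]_n => \sum_(j <- s) (x - z) 0 j * (x - z) 0 j).
  move=> z; rewrite /enorm /dotv.
  exact: (continuous_comp (H _ z) (@sqrt_continuous R _)).
elim: s => [|j s IHs] z.
  rewrite (_ : (fun _ => _) = cst 0); first exact: cst_continuous.
  by apply/funext => u; rewrite big_nil.
rewrite (_ : (fun _ => _) = fun z => (x - z) 0 j * (x - z) 0 j +
  \sum_(j <- s) (x - z) 0 j * (x - z) 0 j); last first.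
  by apply/funext => u; rewrite big_cons.
have cj : {for z, continuous (fun z : 'rV[R]_n => (x - z) 0 j)}.
  rewrite (_ : (fun _ => _) = fun z : 'rV[R]_n => x 0 j - z 0 j); last first.
    by apply/funext => u; rewrite !mxE.
  by apply: continuousB; [exact: cst_continuous|exact: coord_continuous].
exact: (continuousD (continuousM cj cj) (IHs z)).
Qed.

Lemma ball_closed_compact Z x r :
  closed Z -> compact (Z `&` [set z | enorm (x - z) <= r]).
Proof.
move=> cZ; apply: bounded_closed_compact.
  exists (`|x| + `|r|); split; first by rewrite num_real.
  move=> M rM z [_ /= zr]; apply: le_trans (ltW rM).
  rewrite -(subKr x z); apply: le_trans (ler_normB _ _) _; rewrite lerD2l.
  rewrite [leLHS]/Num.norm/= mx_normrE; apply: bigmax_le => // -[i j] _ /=.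
  rewrite (ord1 i) (le_trans (ler_coord_enorm _ _))//.
  exact: le_trans zr (ler_norm _).
apply: closedI => //; apply: (@closed_comp _ _ (fun z => enorm (x - z)) [set t | t <= r]).
  by move=> z _; exact: enormB_continuous.
exact: closed_le.
Qed.

(** Points of [Z] farther from [x] than some fixed [z0] cannot be nearest, so it is enough to
    minimise over a compact piece of [Z]. The minimum is attained there, hence [xget] does not
    return its default. *)
Lemma proj_spec Z x : closed Z -> Z !=set0 ->
  Z (proj Z x) /\ forall z, Z z -> enorm (x - proj Z x) <= enorm (x - z).
Proof.
move=> cZ [z0 Zz0].
pose K := Z `&` [set z | enorm (x - z) <= enorm (x - z0)].
have Kz0 : K !=set0 by exists z0; split => //=.
have [||p pK minp] := EVT_min_rV (f := fun z => enorm (x - z)) Kz0.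
- exact: ball_closed_compact.
- exact/continuous_subspaceT/enormB_continuous.
suff : [set p | Z p /\ forall z, Z z -> enorm (x - p) <= enorm (x - z)] p.
  by move=> Hp; exact: (xgetPex x (ex_intro _ p Hp)).
move: pK; rewrite inE => -[Zp pz0]; split => // z Zz.
have [zz0|/ltW z0z] := leP (enorm (x - z)) (enorm (x - z0)).
  by apply: minp; rewrite inE.
exact: le_trans pz0 z0z.
Qed.

Lemma proj_in Z x : closed Z -> Z !=set0 -> Z (proj Z x).
Proof. by move=> cZ Z0; have [] := proj_spec x cZ Z0. Qed.

Lemma proj_obtuse Z x z : closed Z ->
  convex_set (Z : set (convex_lmodType 'rV[R]_n)) -> Z z ->
  dotv (x - proj Z x) (z - proj Z x) <= 0.
Proof.
move=> cZ vZ Zz; have [Zp minp] := proj_spec x cZ (ex_intro _ z Zz).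
set p := proj Z x in Zp minp *.
have [//|D0] := leP (dotv (x - p) (z - p)) 0; exfalso.
set D := dotv _ _ in D0; set e := enorm (z - p) ^+ 2.
have e0 : 0 <= e by exact: sqr_ge0.
(* moving from p towards z by the fraction a decreases the distance to x *)
pose a := D / (D + e).
have De : 0 < D + e by lra.
have a0 : 0 < a by rewrite divr_gt0.
have a1 : a <= 1 by rewrite ler_pdivrMr//; lra.
have aDe : a * (D + e) = D by rewrite divfK// gt_eqF.
have := minp _ (convex_setP vZ Zz Zp (a := a) _).
rewrite ltW//= a1 => /(_ isT).
have -> : x - (a *: z + (1 - a) *: p) = (x - p) - a *: (z - p).
  by apply/rowP => j; rewrite !mxE; ring.
rewrite -(ler_pXn2r (n := 2)) ?nnegrE ?enorm_ge0// (enormB_sqr _ (a *: _)).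
rewrite dotvZr enormZ (ger0_norm (ltW a0)) exprMn -/D -/e.
have : a * (a * (D + e)) = a * D by rewrite aDe.
have : 0 < a * D by exact: mulr_gt0.
have : 0 <= a ^+ 2 * D by rewrite mulr_ge0 ?sqr_ge0 ?ltW.
lra.
Qed.

(** Split x - z at the projection and expand the square: by [proj_obtuse] the cross term only
    enlarges |x - z|^2. *)
Lemma proj_contract Z x z : closed Z ->
  convex_set (Z : set (convex_lmodType 'rV[R]_n)) -> Z z ->
  enorm (proj Z x - z) <= enorm (x - z).
Proof.
move=> cZ vZ Zz; have ob := proj_obtuse x cZ vZ Zz.
rewrite -(ler_pXn2r (n := 2)) ?nnegrE ?enorm_ge0//.
rewrite -[x - z](subrKA (proj Z x)) -[X in x - _ + X]opprB (enormB_sqr _ (z - _)).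
by rewrite (enormB _ z) lerDr; have := sqr_ge0 (enorm (x - proj Z x)); lra.
Qed.

Lemma dist_le Z x z : Z z -> dist x Z <= enorm (x - z).
Proof.
move=> Zz; apply: ge_inf; last by exists z.
by exists 0 => _ [u _ <-]; exact: enorm_ge0.
Qed.

Lemma le_dist Z x r : Z !=set0 ->
  (forall z, Z z -> r <= enorm (x - z)) -> r <= dist x Z.
Proof.
move=> [z Zz] H; apply: lb_le_inf; first by exists (enorm (x - z)), z.
by move=> _ [u Zu <-]; exact: H.
Qed.

Lemma dist_ge0 Z x : Z !=set0 -> 0 <= dist x Z.
Proof. by move=> Z0; apply: le_dist => // z _; exact: enorm_ge0. Qed.

Lemma dist_lipschitz Z x y : Z !=set0 -> dist x Z - dist y Z <= enorm (x - y).
Proof.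
move=> Z0; rewrite lerBlDr -lerBlDl; apply: le_dist => // z Zz.
rewrite lerBlDl (le_trans (dist_le x Zz))//.
by rewrite -[x - z](subrKA y) ler_enormD.
Qed.

(** Near-minimisers stand in for nearest points, which a set that is merely nonempty may lack. *)
Lemma dist_adherent Z x r : Z !=set0 -> 0 < r ->
  exists2 z, Z z & enorm (x - z) < dist x Z + r.
Proof.
move=> [z0 Zz0] r0.
have [|_ [z Zz <-] ?] := inf_adherent (E := [set enorm (x - z) | z in Z]) r0.
  split; first by exists (enorm (x - z0)), z0.
  by exists 0 => _ [u _ <-]; exact: enorm_ge0.
by exists z.
Qed.

Lemma dist_convex Z x y a : Z !=set0 ->
  convex_set (Z : set (convex_lmodType 'rV[R]_n)) -> 0 <= a <= 1 ->
  dist (a *: x + (1 - a) *: y) Z <= a * dist x Z + (1 - a) * dist y Z.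
Proof.
move=> Z0 vZ a01; have /andP[a0 a1] := a01; apply/ler_addgt0Pr => e e0.
have [p Zp xp] := dist_adherent x Z0 e0; have [q Zq yq] := dist_adherent y Z0 e0.
apply: le_trans (dist_le _ (convex_setP vZ Zp Zq a01)) _.
rewrite [X in enorm X](_ : _ = a *: (x - p) + (1 - a) *: (y - q)); last first.
  by rewrite !scalerBr opprD addrACA.
apply: le_trans (ler_enormD _ _) _; rewrite !enormZ ger0_norm// ger0_norm ?subr_ge0//.
have b0 : 0 <= 1 - a by rewrite subr_ge0.
by have := ler_wpM2l a0 (ltW xp); have := ler_wpM2l b0 (ltW yq); lra.
Qed.

End EuclideanGeometry.

(** * Extended-valued convex functions and the two projected steps of the algorithm *)

Section ConvexFunctions.
Context {R : realType} {n : nat}.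
Implicit Types (x y z u p s : 'rV[R]_n) (h : 'rV[R]_n -> \bar R).

(** Real upper bounds [m] and [r] replace the values of [h], so no arithmetic on infinities
    occurs. *)
Lemma convex_efunP h : convex_efun h -> forall x y (m r a : R),
  (h x <= m%:E)%E -> (h y <= r%:E)%E -> 0 <= a <= 1 ->
  (h (a *: x + (1 - a) *: y)%R <= (a * m + (1 - a) * r)%:E)%E.
Proof.
move=> ch x y m r a hx hy /andP[a0 a1].
have := ch (x, m) (y, r) (Itv01 a0 a1); rewrite !inE/=.
by move=> /(_ hx hy).
Qed.

(** If the subgradient inequality for [h] failed at some [y], convexity would make it fail along the
    segment from [u] to [y]. Close to [u] the affine minorant is still positive, so the inequality
    for [epos h] would fail there too. *)
Lemma subdiff_epos h u s : convex_efun h -> (0 < h u)%E -> (h u < +oo)%E ->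
  subdiff (epos h) u s -> subdiff h u s.
Proof.
move=> ch hu0 huoo sub y; rewrite leNgt; apply/negP => hy.
have [r hur] : exists r, h u = r%:E.
  by case: (h u) hu0 huoo => // r _ _; exists r.
rewrite hur lte_fin in hu0; rewrite hur -EFinD in hy.
set rho := r + _ in hy.
(* A real [m] handles at once a finite value of [h y] and the value -oo. *)
have [m hym mrho] : exists2 m, (h y <= m%:E)%E & m < rho.
  case: (h y) hy => [t| |] //; first by rewrite lte_fin => ?; exists t.
  by move=> _; exists (rho - 1); [rewrite leNye | lra].
(* near u, the value of epos h on the segment towards y is too small *)
pose a := r / (r + `|rho - r| + 1).
have den : 0 < r + `|rho - r| + 1 by have := normr_ge0 (rho - r); lra.
have a0 : 0 < a by rewrite divr_gt0.
have aE : a * (r + `|rho - r| + 1) = r by rewrite divfK// gt_eqF.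
have a1 : a <= 1 by rewrite ler_pdivrMr//; have := normr_ge0 (rho - r); lra.
have := convex_efunP ch hym (r := r) (y := u) (a := a).
rewrite hur lexx ltW//= a1 => /(_ isT isT) hw.
have := sub (a *: y + (1 - a) *: u).
rewrite [X in dotv _ X](_ : _ = a *: (y - u)); last first.
  by apply/rowP => j; rewrite !mxE; ring.
rewrite dotvZr /epos hur -EFin_max (max_l (ltW hu0)) -EFinD leNgt => /negP; apply.
have dE : dotv s (y - u) = rho - r by rewrite /rho; ring.
(* Both arguments of the maximum lie below r + a (rho - r): the value of [h] because m < rho, and 0
   because a |rho - r| < r. *)
rewrite gt_max; apply/andP; split.
  by apply: le_lt_trans hw _; rewrite lte_fin dE; have := ltr_pM2l a0 m rho; rewrite mrho; lra.
rewrite lte_fin dE.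
have : a * (- (rho - r)) <= a * `|rho - r| by rewrite ler_pM2l// -normrN ler_norm.
have : 0 < a * r by exact: mulr_gt0.
lra.
Qed.

(** With [tau] the step length, tau^2 |d|^2 = tau beta gam, so the expanded square drops by at least
    (2 - beta) tau gam = beta (2 - beta) gam^2 / |d|^2. The bound on |d| then gives a uniform
    coefficient. *)
Lemma polyak_step (Y : set 'rV[R]_n) (beta Mg gam : R) z p d :
  closed Y -> convex_set (Y : set (convex_lmodType 'rV[R]_n)) -> Y p ->
  0 <= beta <= 2 -> 0 < gam -> gam <= dotv d (z - p) -> enorm d <= Mg ->
  enorm (proj Y (z - (beta * (gam / enorm d ^+ 2)) *: d) - p) ^+ 2 <=
  enorm (z - p) ^+ 2 - beta * (2 - beta) / Mg ^+ 2 * gam ^+ 2.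
Proof.
move=> cY vY Yp /andP[b0 b2] g0 gd dM.
have d0 : 0 < enorm d.
  rewrite lt_neqAle enorm_ge0 andbT eq_sym; apply/eqP => /enorm_eq0 d0.
  by move: gd; rewrite d0 dotv0l leNgt g0.
have d2 : 0 < enorm d ^+ 2 by exact: exprn_gt0.
set tau := beta * _.
have tau0 : 0 <= tau by apply: mulr_ge0 => //; rewrite divr_ge0 ?ltW.
have : enorm (proj Y (z - tau *: d) - p) ^+ 2 <= enorm (z - tau *: d - p) ^+ 2.
  by rewrite ler_pXn2r ?nnegrE ?enorm_ge0// proj_contract.
move=> /le_trans; apply.
rewrite addrAC (enormB_sqr _ (_ *: _)) dotvZr enormZ (ger0_norm tau0) exprMn (dotvC _ d).
have t2 : tau ^+ 2 * enorm d ^+ 2 = tau * (beta * gam).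
  by rewrite /tau; field; rewrite gt_eqF.
have td := ler_wpM2l tau0 gd.
have : beta * (2 - beta) / Mg ^+ 2 * gam ^+ 2 <= (2 - beta) * (tau * gam).
  rewrite [leRHS](_ : _ = beta * (2 - beta) / enorm d ^+ 2 * gam ^+ 2); last first.
    by rewrite /tau; field; rewrite gt_eqF.
  rewrite ler_wpM2r ?sqr_ge0// ler_wpM2l ?mulr_ge0 ?subr_ge0//.
  rewrite lef_pV2 ?posrE ?exprn_gt0 ?(lt_le_trans d0)//.
  by rewrite ler_pXn2r ?nnegrE ?(ltW d0)// (le_trans _ dM) ?ltW.
rewrite t2; lra.
Qed.

Lemma proj_gradient_step (Y : set 'rV[R]_n) (a M : R) u p s :
  closed Y -> convex_set (Y : set (convex_lmodType 'rV[R]_n)) -> Y p ->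
  enorm s <= M ->
  enorm (proj Y (u - a *: s) - p) ^+ 2 <=
  enorm (u - p) ^+ 2 - 2 * a * dotv s (u - p) + a ^+ 2 * M ^+ 2.
Proof.
move=> cY vY Yp sM.
have : enorm (proj Y (u - a *: s) - p) ^+ 2 <= enorm (u - a *: s - p) ^+ 2.
  by rewrite ler_pXn2r ?nnegrE ?enorm_ge0// proj_contract.
move=> /le_trans; apply.
rewrite addrAC (enormB_sqr _ (_ *: _)) dotvZr enormZ exprMn (dotvC _ s) real_normK ?num_real//.
rewrite -[2 * a * _]mulrA lerD2l ler_wpM2l ?sqr_ge0// ler_pXn2r ?nnegrE ?enorm_ge0//.
exact: le_trans (enorm_ge0 s) sM.
Qed.

End ConvexFunctions.

(** * Integration of bounded random variables *)

Section BoundedRandomVariables.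
Context {R : realType} {d} {T : measurableType d} (P : probability T R).
Implicit Types (D : set T).

(** A class stable under linear combinations whose members are integrable over every event, which
    settles the integrability side conditions. *)
Definition bounded_rv (phi : T -> R) : Prop :=
  measurable_fun setT phi /\ exists M, forall w, `|phi w| <= M.

Lemma bounded_rv_cst r : bounded_rv (cst r).
Proof. by split; [exact: measurable_cst|exists `|r|]. Qed.

Lemma bounded_rvD (phi psi : T -> R) : bounded_rv phi -> bounded_rv psi ->
  bounded_rv (fun w => phi w + psi w).
Proof.
move=> [mphi [M phiM]] [mpsi [L psiL]]; split; first exact: measurable_funD.
by exists (M + L) => w; rewrite (le_trans (ler_normD _ _))// lerD.
Qed.

Lemma bounded_rvZ r (phi : T -> R) : bounded_rv phi -> bounded_rv (fun w => r * phi w).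
Proof.
move=> [mphi [M phiM]]; split.
  by apply: measurable_funM => //; exact: measurable_cst.
by exists (`|r| * M) => w; rewrite normrM ler_wpM2l.
Qed.

Lemma bounded_rvB (phi psi : T -> R) : bounded_rv phi -> bounded_rv psi ->
  bounded_rv (fun w => phi w - psi w).
Proof.
move=> bphi /(bounded_rvZ (-1)) /(bounded_rvD bphi).
by under eq_fun do rewrite mulN1r.
Qed.

Lemma bounded_rv_sum (a : nat -> R) (phi : nat -> T -> R) (s : seq nat) :
  (forall k, bounded_rv (phi k)) ->
  bounded_rv (fun w => \sum_(k <- s) a k * phi k w).
Proof.
move=> bphi; elim: s => [|k s IHs].
  rewrite (_ : (fun _ => _) = cst 0); first exact: bounded_rv_cst.
  by apply/funext => w; rewrite big_nil.
rewrite (_ : (fun _ => _) = fun w => a k * phi k w + \sum_(k <- s) a k * phi k w).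
  exact/bounded_rvD/IHs/bounded_rvZ.
by apply/funext => w; rewrite big_cons.
Qed.

Lemma bounded_rv_integrable D (phi : T -> R) : measurable D -> bounded_rv phi ->
  P.-integrable D (EFin \o phi).
Proof.
move=> mD [mphi [M phiM]]; apply: measurable_bounded_integrable => //.
- by apply: le_lt_trans (probability_le1 P mD) _; rewrite ltry.
- exact: measurable_funTS.
- exists M; split; first by rewrite num_real.
  by move=> N MN w _ /=; rewrite (le_trans (phiM w))// ltW.
Qed.

Lemma Rintegral_sum (a : nat -> R) (phi : nat -> T -> R) (s : seq nat) :
  (forall k, bounded_rv (phi k)) ->
  \int[P]_w (\sum_(k <- s) a k * phi k w) = \sum_(k <- s) a k * \int[P]_w phi k w.
Proof.
move=> bphi; elim: s => [|k s IHs].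
  rewrite big_nil -[RHS](mul0r (fine (P setT))) -Rintegral_cst//.
  by apply: eq_Rintegral => w _; rewrite big_nil.
rewrite big_cons -IHs -RintegralZl//; last exact: bounded_rv_integrable.
rewrite -RintegralD//; last 2 first.
- exact/bounded_rv_integrable/bounded_rvZ.
- exact/bounded_rv_integrable/bounded_rv_sum.
by apply: eq_Rintegral => w _; rewrite big_cons.
Qed.

Lemma Rintegral_partition_le0 (I : finType) (idx : T -> I) (phi : T -> R) :
  (forall i, measurable (idx @^-1` [set i])) -> bounded_rv phi ->
  (forall i, \int[P]_(w in idx @^-1` [set i]) phi w <= 0) ->
  \int[P]_w phi w <= 0.
Proof.
move=> midx bphi phi0.
have TE : [set: T] = \big[setU/set0]_(i <- index_enum I) (idx @^-1` [set i]).
  apply/esym/seteqP; split => // w _.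
  by rewrite -bigcup_seq; exists (idx w) => //=; rewrite mem_index_enum.
rewrite /Rintegral TE integral_bigsetU_EFin//; first last.
- by rewrite -TE; apply/measurable_EFinP; case: bphi.
- by move=> i j _ _ [w [/= <- <-]].
- exact: index_enum_uniq.
have fin i : (\int[P]_(w in idx @^-1` [set i]) (phi w)%:E)%E \is a fin_num.
  exact/integrable_fin_num/bounded_rv_integrable.
rewrite (eq_bigr (fun i => (\int[P]_(w in idx @^-1` [set i]) phi w)%:E)).
  by rewrite sumEFin/= sumr_le0.
by move=> i _; rewrite /Rintegral fineK.
Qed.

(** The integral of a nonnegative function is a supremum over the simple functions below it, hence
    monotone. This serves for integrands that are bounded pointwise and not shown to be
    measurable. *)
Lemma le_integral_nonneg (phi psi : T -> \bar R) :
  (forall w, (0 <= phi w)%E) -> (forall w, (phi w <= psi w)%E) ->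
  (\int[P]_w phi w <= \int[P]_w psi w)%E.
Proof.
move=> phi0 phipsi; rewrite !ge0_integralTE//; last first.
  by move=> w; exact: le_trans (phi0 w) (phipsi w).
apply: ereal_sup_le => _ [h hphi <-]; exists h => //= w.
exact: le_trans (hphi w) (phipsi w).
Qed.

End BoundedRandomVariables.

(** * Measurable partitions and Lipschitz functions of random vectors *)

Section RandomVectors.
Context {R : realType} {n : nat} {d} {T : measurableType d}.
Implicit Types (u : T -> 'rV[R]_n) (Y : set 'rV[R]_n).

(* A grid of mesh h / (n + 1) on the box of half-side B. *)
Lemma vmeasurable_partition u (B h : R) :
  vmeasurable measurable u -> (forall w j, `|u w 0 j| <= B) -> 0 < h ->
  exists (I : finType) (idx : T -> I),
    (forall i, measurable (idx @^-1` [set i])) /\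
    forall w w', idx w = idx w' -> enorm (u w - u w') <= h.
Proof.
move=> mu uB h0; pose e := h / n.+1%:R.
have e0 : 0 < e by rewrite divr_gt0.
(* Grid index of coordinate [j]; the shift by [B] makes the truncated number nonnegative. *)
pose c w j := Num.trunc ((u w 0 j + B) / e).
have c_itv w j : (c w j)%:R * e <= u w 0 j + B < (c w j).+1%:R * e.
  have := uB w j; rewrite ler_norml => /andP[uB1 uB2].
  have /truncn_itv/andP[] : 0 <= (u w 0 j + B) / e.
    by rewrite divr_ge0 ?(ltW e0)//; lra.
  by rewrite ler_pdivlMr// ltr_pdivrMr// => -> ->.
pose M := Num.trunc ((B + B) / e).
have cM w j : (c w j < M.+1)%N.
  have := uB w j; rewrite ler_norml => /andP[uB1 uB2].
  rewrite ltnS; apply: le_truncn; rewrite ler_pM2r ?invr_gt0//; lra.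
exists {ffun 'I_n -> 'I_M.+1}, (fun w => [ffun j => Ordinal (cM w j)]); split.
  move=> i; rewrite (_ : _ @^-1` _ = \bigcap_(j in [set: 'I_n])
    (fun w => u w 0 j) @^-1` [set` `[(i j)%:R * e - B, (i j).+1%:R * e - B[%R]).
    by apply: fin_bigcap_measurable => // j _; apply: mu; exact: measurable_itv.
  apply/seteqP; split => [w <- j _|w wi].
    by rewrite /= in_itv/= !ffunE/= lerBlDr ltrBrDr c_itv.
  apply/ffunP => j; rewrite ffunE; apply/val_inj => /=.
  have := wi j I; rewrite /= in_itv/= lerBlDr ltrBrDr => /andP[i1 i2].
  have /andP[c1 c2] := c_itv w j.
  have ic : (i j)%:R < (c w j).+1%:R :> R.
    by rewrite -(ltr_pM2r e0) (le_lt_trans i1).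
  have ci : (c w j)%:R < (i j).+1%:R :> R.
    by rewrite -(ltr_pM2r e0) (le_lt_trans c1).
  by rewrite !ltr_nat !ltnS in ic ci; apply/eqP; rewrite eqn_leq ic ci.
move=> w w' /ffunP ww'; apply: le_trans (enorm_le_sum _) _.
apply: (@le_trans _ _ (\sum_(j < n) e)).
  apply: ler_sum => j _; rewrite !mxE.
  have := ww' j; rewrite !ffunE => /(congr1 val)/= cc.
  have := c_itv w j; have := c_itv w' j; rewrite cc -natr1 ler_norml.
  by move=> /andP[? ?] /andP[? ?]; apply/andP; split; lra.
rewrite sumr_const card_ord -mulr_natr /e -mulrA ger_pMr//.
by rewrite mulrC ler_pdivrMr// mul1r ler_nat.
Qed.

(** On the cells of finer and finer partitions, [phi \o u] is approximated uniformly by functions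
    constant on each cell; a limit of measurable functions is measurable. *)
Lemma measurable_lipschitz_comp u Y (B L : R) (phi : 'rV[R]_n -> R) :
  vmeasurable measurable u -> (forall w j, `|u w 0 j| <= B) -> (forall w, Y (u w)) ->
  0 <= L -> (forall y z, Y y -> Y z -> phi y - phi z <= L * enorm (y - z)) ->
  measurable_fun setT (phi \o u).
Proof.
move=> mu uB Yu L0 lip.
have /choice[h hP] (m : nat) : exists h : T -> R, measurable_fun setT h /\
    forall w, `|phi (u w) - h w| <= L * m.+1%:R^-1.
  have [|I [idx [midx close]]] := vmeasurable_partition mu uB (h := m.+1%:R^-1).
    by rewrite invr_gt0.
  (* Value of [phi] at a representative of the cell; the default 0 concerns empty cells only. *)
  pose val i := if pselect (exists w, idx w = i) is left e
                then phi (u (projT1 (cid e))) else 0.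
  exists (val \o idx); split.
    move=> _ D _; rewrite setTI (_ : _ @^-1` _ =
      \bigcup_(i in [set i | D (val i)]) idx @^-1` [set i]).
      exact: fin_bigcup_measurable.
    by apply/seteqP; split => [w Dw|w [i Di /= wi]]; [by exists (idx w)|by rewrite /= wi].
  move=> w; rewrite /= /val; case: pselect => [e|[]]; last by exists w.
  case: cid => w' /= /close ww'.
  rewrite ler_norml lerNl opprB.
  have L1 := ler_wpM2l L0 ww'.
  by rewrite (le_trans (lip _ _ (Yu _) (Yu _)))//= (le_trans (lip _ _ (Yu _) (Yu _)))// enormB.
apply: (measurable_fun_cvg (h := h)) => [m|w _]; first by case: (hP m).
apply/cvgrPdist_le => e e0.
near=> m; have [_ /(_ w) /le_trans] := hP m; apply.
have Lm : L / e < m.+1%:R.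
  near: m; exists (Num.trunc (L / e)) => // k /= Nk.
  have /andP[_ le] := truncn_itv (divr_ge0 L0 (ltW e0)).
  by rewrite (lt_le_trans le)// ler_nat ltnS.
by rewrite ler_pdivrMr// mulrC -ler_pdivrMr// ltW.
Unshelve. all: by end_near. Qed.

End RandomVectors.

(** * Substituting a random vector into a conditional inequality *)

Section Freezing.
Context {R : realType} {n : nat} {d} {T : measurableType d} (P : probability T R).
Implicit Types (u : T -> 'rV[R]_n) (Y : set 'rV[R]_n).

(* An inequality between D(y) and the conditional expectation of Gam(., y) that
   holds for every deterministic y survives the substitution of a random vector
   u measurable for the conditioning sigma-field: it is first applied with y
   frozen to one value of u on each cell of a fine measurable partition. *)
Lemma freezing (F : set (set T)) u Y (D : 'rV[R]_n -> R)
    (Gam : T -> 'rV[R]_n -> R) (psi : T -> R) (B LD L c : R) :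
  <<s F>> `<=` measurable ->
  vmeasurable <<s F>> u -> (forall w j, `|u w 0 j| <= B) -> (forall w, Y (u w)) ->
  0 <= LD -> (forall y z, Y y -> Y z -> D y - D z <= LD * enorm (y - z)) ->
  0 <= L ->
  (forall w y z, Y y -> Y z -> Gam w y - Gam w z <= L * enorm (y - z)) ->
  (forall w y, 0 <= Gam w y) -> (forall y, Y y -> measurable_fun setT (Gam ^~ y)) ->
  bounded_rv (D \o u) -> bounded_rv psi -> (forall w, Gam w (u w) <= psi w) ->
  0 <= c ->
  (forall y S, Y y -> <<s F>> S ->
     ((D y)%:E * P S <= c%:E * \int[P]_(w in S) (Gam w y)%:E)%E) ->
  \int[P]_w D (u w) <= c * \int[P]_w psi w.
Proof.
move=> subF mu uB Yu LD0 lipD L0 lipG G0 mG bD bpsi Gpsi c0 H.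
(* Freezing on cells of diameter [h] costs LD h for [D] and c L h for [Gam]; then [h] tends to 0. *)
suff cells (h : R) : 0 < h ->
    \int[P]_w (D (u w) - (c * psi w + (LD + c * L) * h)) <= 0.
  apply/ler_addgt0Pr => e e0.
  have K0 : 0 < LD + c * L + 1 by rewrite ltr_wpDl// addr_ge0// mulr_ge0.
  have := cells _ (divr_gt0 e0 K0); set r := _ * (e / _).
  have re : r <= e.
    by rewrite /r mulrCA ger_pMr// ler_pdivrMr// mul1r lerDl.
  have bc := bounded_rvZ c bpsi; have br := @bounded_rv_cst R d T r.
  rewrite RintegralB//; last 2 first.
  - exact: bounded_rv_integrable.
  - exact/bounded_rv_integrable/bounded_rvD.
  rewrite RintegralD//; last 2 first.
  - exact: bounded_rv_integrable.
  - exact: (bounded_rv_integrable _ _ br).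
  rewrite RintegralZl//; last exact: bounded_rv_integrable.
  by rewrite Rintegral_cst// (_ : fine (P setT) = 1) ?mulr1 ?probability_setT//; lra.
move=> h0.
have [I [idx [midx close]]] : exists (I : finType) (idx : T -> I),
    (forall i, <<s F>> (idx @^-1` [set i])) /\
    forall w w', idx w = idx w' -> enorm (u w - u w') <= h.
  (* The partition is taken in the space equipped with the conditioning sigma-field, so that its
     cells are admissible events [S] in [H]. *)
  exact: (@vmeasurable_partition R n _ (g_sigma_algebraType F) u B h mu uB h0).
apply: (@Rintegral_partition_le0 R d T P I idx) => [i||i].
- by apply: subF; exact: midx.
- apply: bounded_rvB => //; apply: bounded_rvD; first exact: bounded_rvZ.
  exact: bounded_rv_cst.
set S := idx @^-1` [set i]; have mS : measurable S by apply: subF; exact: midx.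
have [[w0 Sw0]|S0] := pselect (exists w, S w); last first.
  have -> : S = set0 by apply/seteqP; split => // w Sw; apply: S0; exists w.
  by rewrite Rintegral_set0.
set y := u w0; have Yy : Y y by exact: Yu.
have closey w : S w -> enorm (u w - y) <= h by rewrite /S/= => Sw; apply: close; rewrite Sw.
pose psi' w := psi w + L * h.
have bpsi' : bounded_rv psi' by apply: bounded_rvD => //; exact: bounded_rv_cst.
have Gpsi' w : S w -> Gam w y <= psi' w.
  move=> Sw; have := lipG w _ _ Yy (Yu w); rewrite enormB.
  have := ler_wpM2l L0 (closey _ Sw); have := Gpsi w; rewrite /psi'; lra.
apply: (@le_trans _ _ (\int[P]_(w in S) (D y - c * psi' w))).
  apply: le_Rintegral => //.
  - apply: bounded_rv_integrable => //; apply: bounded_rvB => //; apply: bounded_rvD.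
      exact: bounded_rvZ.
    exact: bounded_rv_cst.
  - apply: bounded_rv_integrable => //; apply: bounded_rvB; last exact: bounded_rvZ.
    exact: bounded_rv_cst.
  move=> w Sw; have := lipD _ _ (Yu w) Yy.
  have := ler_wpM2l LD0 (closey _ Sw); rewrite /psi'; lra.
rewrite RintegralB//; last 2 first.
- exact: (bounded_rv_integrable _ _ (bounded_rv_cst _)).
- exact/bounded_rv_integrable/bounded_rvZ.
rewrite Rintegral_cst// RintegralZl//; last exact: bounded_rv_integrable.
rewrite subr_le0 -lee_fin EFinM fineK ?fin_num_measure//.
apply: le_trans (H y S Yy (midx i)) _.
rewrite EFinM fineK; last exact/integrable_fin_num/bounded_rv_integrable.
apply: lee_wpmul2l; first by rewrite lee_fin.
apply: ge0_le_integral => //.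
- by move=> w _; rewrite lee_fin.
- by apply/measurable_EFinP; apply: measurable_funTS; exact: mG.
- by apply/measurable_EFinP; apply: measurable_funTS; case: bpsi'.
Qed.

End Freezing.

(** Factor a^2 - b^2; this carries Lipschitz bounds over to squares of bounded functions. *)
Lemma ler_sqrB_bounded (R : realDomainType) (M a b r : R) : 0 <= a <= M -> 0 <= b <= M -> 0 <= r ->
  a - b <= r -> a ^+ 2 - b ^+ 2 <= 2 * M * r.
Proof.
move=> /andP[a0 aM] /andP[b0 bM] r0 abr.
have ab : 0 <= a + b by lra.
have := ler_wpM2l ab abr.
have : (a + b) * r <= 2 * M * r by rewrite ler_wpM2r//; lra.
by rewrite subr_sqr mulrC; lra.
Qed.

(** * A contraction perturbed by terms of order 1/k^2 *)

Section InverseSquareRecursion.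
Context {R : realType}.

Lemma inverse_square_rate (delta : nat -> R) (rho L B : R) :
  0 <= rho < 1 -> 0 <= L -> (forall k, delta k <= B) ->
  (forall k, (1 <= k)%N -> delta k <= rho * delta k.-1 + L / k%:R ^+ 2) ->
  exists2 K, 0 <= K & forall k, delta k <= K / k.+1%:R ^+ 2.
Proof.
move=> /andP[rho0 rho1] L0 dB rec.
(* for k >= m, passing from 1/k^2 to 1/(k+1)^2 costs at most half of the gap *)
pose m := (Num.trunc (4 / (1 - rho))).+1.
have r1 : 0 < 1 - rho by rewrite subr_gt0.
have mE : 4 < (1 - rho) * m%:R.
  have /truncn_itv/andP[_] : 0 <= 4 / (1 - rho) by rewrite divr_ge0// ltW.
  by rewrite ltr_pdivrMr// mulrC.
(* The first term covers the indices up to [m] through the bound [B], the second absorbs the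
   perturbation. *)
pose K := `|B| * m.+1%:R ^+ 2 + 2 * L / (1 - rho).
have L' : 0 <= 2 * L / (1 - rho) by rewrite divr_ge0 ?mulr_ge0// ltW.
have B' : 0 <= `|B| * m.+1%:R ^+ 2 by rewrite mulr_ge0// sqr_ge0.
have K0 : 0 <= K by exact: addr_ge0.
exists K => // k; have k0 j : 0 < j.+1%:R ^+ 2 :> R by rewrite exprn_gt0.
elim: k => [|k IHk].
  rewrite expr1n divr1 (le_trans (dB _))// (le_trans (ler_norm B))//.
  by rewrite -[leLHS]mulr1 /K ler_wpDr// ler_wpM2l// expr_ge1// ler1n.
have [km|mk] := leqP k.+1 m.
  rewrite ler_pdivlMr// (le_trans (ler_wpM2r (ltW (k0 _)) (le_trans (dB k.+1) (ler_norm B))))//.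
  rewrite /K ler_wpDr// ler_wpM2l// ler_pXn2r ?nnegrE// ler_nat; exact: km.
apply: le_trans (rec k.+1 isT) _ => /=.
have IH' := ler_wpM2l rho0 IHk.
rewrite ler_pdivlMr//.
set s := k.+1%:R in mk IH' *.
have sm : m%:R <= s by rewrite ler_nat ltnW.
have s0 : 0 < s by rewrite ltr0n.
have s1 : 1 <= s by rewrite ler1n.
have -> : k.+2%:R = s + 1 :> R by rewrite -natr1.
have sE : 4 <= (1 - rho) * s by rewrite (le_trans (ltW mE))// ler_wpM2l// ltW.
have KL : 2 * L <= (1 - rho) * K.
  rewrite (_ : (1 - rho) * K = (1 - rho) * (`|B| * m.+1%:R ^+ 2) + 2 * L).
    by rewrite lerDr mulr_ge0// ltW.
  by rewrite /K; field; rewrite gt_eqF.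
have : rho * delta k + L / s ^+ 2 <= (rho * K + L) / s ^+ 2 by rewrite [leRHS]mulrDl -mulrA lerD2r.
move=> H; apply: le_trans (ler_wpM2r (sqr_ge0 (s + 1)) H) _.
rewrite mulrAC ler_pdivrMr ?exprn_gt0//.
(* Half of the gap 1 - rho pays for [L]; the other half pays, in the next inequality, for the factor
   ((s + 1) / s)^2. *)
have : 2 * (rho * K + L) <= (1 + rho) * K by lra.
have : (s + 1) ^+ 2 * (1 + rho) <= 2 * s ^+ 2.
  have := ler_wpM2l (ltW s0) sE; lra.
move=> H1 H2.
have := ler_wpM2l K0 H1; have := ler_wpM2r (sqr_ge0 (s + 1)) H2; lra.
Qed.

End InverseSquareRecursion.

(** * The weights (k+1)^2 and Jensen's inequality for the average *)

Section WeightedAverage.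
Context {R : realType}.

Lemma avg_weightS t : avg_weight R t.+1 = avg_weight R t + (t.+2)%:R ^+ 2.
Proof. by rewrite /avg_weight big_nat_recr. Qed.

Lemma avg_weight_ge0 t : 0 <= avg_weight R t.
Proof. by apply: sumr_ge0 => k _; rewrite sqr_ge0. Qed.

Lemma avg_weight_gt0 t : (0 < t)%N -> 0 < avg_weight R t.
Proof.
case: t => // t _; rewrite avg_weightS.
by apply: ltr_wpDl; rewrite ?avg_weight_ge0// exprn_gt0.
Qed.

Lemma onem_avg_weight t :
  1 - avg_weight R t / avg_weight R t.+1 = (t.+2)%:R ^+ 2 / avg_weight R t.+1.
Proof.
have S0 : avg_weight R t.+1 != 0 by rewrite gt_eqF// avg_weight_gt0.
by apply: (mulIf S0); rewrite mulrBl !divfK// mul1r avg_weightS; ring.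
Qed.

(** Both sums have closed forms, and the difference is a polynomial in [t] with nonnegative
    coefficients. Through this bound, terms of order 1/(k+1) average to order 1/t. *)
Lemma sumS_avg_weight t :
  t%:R * \sum_(1 <= k < t.+1) (k.+1)%:R <= 2 * avg_weight R t.
Proof.
have sumE : 2 * \sum_(1 <= k < t.+1) (k.+1)%:R = t%:R ^+ 2 + 3 * t%:R :> R.
  elim: t => [|t IHt]; first by rewrite big_geq// !(mulr0, expr0n) addr0.
  by rewrite big_nat_recr//= mulrDr IHt -!natr1; ring.
have SE : 6 * avg_weight R t = 2 * t%:R ^+ 3 + 9 * t%:R ^+ 2 + 13 * t%:R.
  elim: t {sumE} => [|t IHt]; first by rewrite /avg_weight big_geq// !(mulr0, expr0n) !addr0.
  by rewrite avg_weightS mulrDr IHt -!natr1; ring.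
rewrite -(ler_pM2l (x := 6))//.
rewrite [leLHS](_ : _ = 3 * t%:R * (2 * \sum_(1 <= k < t.+1) (k.+1)%:R)); last ring.
rewrite [leRHS](_ : _ = 2 * (6 * avg_weight R t)); last ring.
rewrite sumE SE -subr_ge0 [leRHS](_ : _ = t%:R ^+ 3 + 9 * t%:R ^+ 2 + 26 * t%:R); last ring.
by rewrite !addr_ge0// ?mulr_ge0// ?exprn_ge0.
Qed.

Lemma sumS_div_avg_weight t : (0 < t)%N ->
  (\sum_(1 <= k < t.+1) k.+1%:R) / avg_weight R t <= 2 / t%:R.
Proof.
move=> t0; rewrite ler_pdivrMr ?avg_weight_gt0// mulrAC ler_pdivlMr ?ltr0n//.
by rewrite mulrC sumS_avg_weight.
Qed.

Context {n : nat} {T : Type}.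
Implicit Types (x : nat -> T -> 'rV[R]_n) (Y : set 'rV[R]_n).

(** Each average is a two-point convex combination of the previous one and the new iterate, which
    permits Jensen's inequality by induction. *)
Lemma averageS x t w : (0 < t)%N ->
  let a := avg_weight R t / avg_weight R t.+1 in
  average x t.+1 w = a *: average x t w + (1 - a) *: x t.+1 w.
Proof.
move=> t0 a; rewrite /average big_nat_recr//= scaler_sumr.
have S0 := avg_weight_gt0 t0; have S1 := @avg_weight_gt0 t.+1 isT.
congr (_ + _); last first.
  by rewrite /a onem_avg_weight.
apply: eq_bigr => k _; rewrite scalerA; congr (_ *: _).
by rewrite /a; field; rewrite !gt_eqF.
Qed.

Lemma average_convex x Y (phi : 'rV[R]_n -> R) w t :
  convex_set (Y : set (convex_lmodType 'rV[R]_n)) ->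
  (forall u y a, Y u -> Y y -> 0 <= a <= 1 ->
     phi (a *: u + (1 - a) *: y) <= a * phi u + (1 - a) * phi y) ->
  (forall k, Y (x k w)) -> (0 < t)%N ->
  Y (average x t w) /\
  phi (average x t w) <= \sum_(1 <= k < t.+1) (k.+1)%:R ^+ 2 / avg_weight R t * phi (x k w).
Proof.
move=> vY cphi Yx; elim: t => // -[|t] IHt _.
  have -> : average x 1 w = x 1 w.
    by rewrite /average /avg_weight !big_nat1 divff ?expf_neq0 ?pnatr_eq0// scale1r.
  by rewrite /avg_weight !big_nat1 divff ?expf_neq0 ?pnatr_eq0// mul1r; split.
have [//|Ya phia] := IHt; rewrite averageS//; set a := _ / _.
have S0 := @avg_weight_gt0 t.+1 isT; have S1 := @avg_weight_gt0 t.+2 isT.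
have a01 : 0 <= a <= 1.
  by rewrite /a divr_ge0 ?avg_weight_ge0//= ler_pdivrMr// mul1r [leRHS]avg_weightS lerDl sqr_ge0.
split; first exact: convex_setP.
apply: le_trans (cphi _ _ _ Ya (Yx _) a01) _; rewrite big_nat_recr//=.
apply: lerD; last first.
  by rewrite /a onem_avg_weight.
have /andP[a0 _] := a01; apply: le_trans (ler_wpM2l a0 phia) _.
rewrite mulr_sumr; apply: ler_sum => k _; rewrite mulrA.
by rewrite le_eqVlt; apply/orP; left; apply/eqP; congr (_ * _); rewrite /a; field; rewrite !gt_eqF.
Qed.

End WeightedAverage.

(** * Deterministic consequences of the assumptions on [f], [g] and [Y] *)

Section Problem.
Context {R : realType} {n : nat} {dA} {A : measurableType dA} (Y : set 'rV[R]_n)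
  (f : 'rV[R]_n -> \bar R) (g : A -> 'rV[R]_n -> \bar R)
  (fstar mu Mf Mg : R) (sf : 'rV[R]_n -> 'rV[R]_n).
Local Notation X := (feasible Y g).
Context (g_convex : forall a, convex_efun (g a))
  (f_dom : Y `<=` edom f) (g_dom : forall a, Y `<=` edom (g a))
  (fstarE : ereal_inf [set f u | u in X] = fstar%:E)
  (Y_convex : convex_set (Y : set (convex_lmodType 'rV[R]_n)))
  (X_nonempty : X !=set0)
  (Xstar_nonempty : [set u | X u /\ f u = fstar%:E] !=set0)
  (mu_gt0 : 0 < mu) (Mg_gt0 : 0 < Mg)
  (f_strong : forall u y s, Y u -> Y y -> subdiff f u s ->
     (f u + (dotv s (y - u))%:E + (mu / 2 * enorm (y - u) ^+ 2)%:E <= f y)%E)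
  (f_bound : forall u s, Y u -> subdiff f u s -> enorm s <= Mf)
  (g_bound : forall a u s, Y u -> subdiff (g a) u s -> enorm s <= Mg)
  (sf_subdiff : forall u, Y u -> subdiff f u (sf u))
  (g_subdiff : forall a u, Y u -> (0 < g a u)%E -> subdiff (epos (g a)) u !=set0).
Implicit Types (u y p s : 'rV[R]_n) (a : A).

Definition fval u : R := fine (f u).

(** The domain assumption excludes +oo; the affine minorant given by a subgradient at an optimal
    point excludes -oo. *)
Lemma fvalE u : Y u -> f u = (fval u)%:E.
Proof.
move=> Yu; rewrite fineK//; have [p [[Yp _] fp]] := Xstar_nonempty.
have := sf_subdiff Yp u; have := f_dom Yu; rewrite /edom/= fp.
by case: (f u).
Qed.

Lemma fval_sub u y : Y u -> Y y -> fval u + dotv (sf u) (y - u) <= fval y.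
Proof.
by move=> Yu Yy; have := sf_subdiff Yu y; rewrite !fvalE// -EFinD lee_fin.
Qed.

Lemma fval_strong u y : Y u -> Y y ->
  fval u + dotv (sf u) (y - u) + mu / 2 * enorm (y - u) ^+ 2 <= fval y.
Proof.
move=> Yu Yy; have := f_strong Yu Yy (sf_subdiff Yu).
by rewrite !fvalE// -!EFinD lee_fin.
Qed.

Lemma sf_bound u : Y u -> enorm (sf u) <= Mf.
Proof. by move=> Yu; exact: f_bound (sf_subdiff Yu). Qed.

(** Adding the strong convexity inequalities at [u] and at [y] gives mu |u - y|^2 <= <sf u - sf y, u
    - y> <= 2 Mf |u - y|. *)
Lemma diameter_le u y : Y u -> Y y -> enorm (u - y) <= 2 * Mf / mu.
Proof.
move=> Yu Yy; rewrite ler_pdivlMr// mulrC.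
have Mf0 : 0 <= Mf by apply: le_trans (enorm_ge0 _) (sf_bound Yu).
have [->|e0] := eqVneq (enorm (u - y)) 0; first by rewrite mulr0 mulr_ge0.
have {}e0 : 0 < enorm (u - y) by rewrite lt_neqAle eq_sym e0 enorm_ge0.
rewrite -(ler_pM2r e0).
have := fval_strong Yu Yy; have := fval_strong Yy Yu.
rewrite (enormB y u) -(opprB u y) dotvNr.
have := cauchy_schwarz (sf u) (u - y); have := cauchy_schwarz (sf y) (u - y).
have := ler_wpM2r (ltW e0) (sf_bound Yu); have := ler_wpM2r (ltW e0) (sf_bound Yy).
rewrite !ler_norml => ? ? /andP[? ?] /andP[? ?]; lra.
Qed.

Lemma fval_lipschitz u y : Y u -> Y y -> fval u - fval y <= Mf * enorm (u - y).
Proof.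
move=> Yu Yy; have := fval_sub Yu Yy; rewrite -(opprB u y) dotvNr.
have := dotv_le (sf u) (u - y).
by have := ler_wpM2r (enorm_ge0 (u - y)) (sf_bound Yu); lra.
Qed.

(** Combine the subgradient inequalities at the intermediate point [z]; the linear terms cancel. *)
Lemma fval_convex u y (a : R) : Y u -> Y y -> 0 <= a <= 1 ->
  fval (a *: u + (1 - a) *: y) <= a * fval u + (1 - a) * fval y.
Proof.
move=> Yu Yy a01; have Yz := convex_setP Y_convex Yu Yy a01.
have /andP[a0 a1] := a01; have b0 : 0 <= 1 - a by rewrite subr_ge0.
set z := _ + _ in Yz *.
have := ler_wpM2l a0 (fval_sub Yz Yu); have := ler_wpM2l b0 (fval_sub Yz Yy).
have : a * dotv (sf z) (u - z) + (1 - a) * dotv (sf z) (y - z) = 0.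
  rewrite -!dotvZr -dotvDr [X in dotv _ X](_ : _ = 0) ?dotv0r//.
  by apply/rowP => j; rewrite !mxE; ring.
lra.
Qed.

Lemma fval_feasible p : X p -> fstar <= fval p.
Proof.
move=> Xp; rewrite -lee_fin -fvalE; last by case: Xp.
by rewrite -fstarE; apply: ereal_inf_lbound; exists p.
Qed.

(** Compare [u] with an almost nearest feasible point, where [fval] is at least [fstar], using the
    Lipschitz bound. *)
Lemma fval_lower u : Y u -> fstar - Mf * dist u X <= fval u.
Proof.
move=> Yu; have Mf0 : 0 <= Mf by apply: le_trans (enorm_ge0 _) (sf_bound Yu).
apply/ler_addgt0Pr => e e0.
have e1 : 0 < e / (Mf + 1) by rewrite divr_gt0// ltr_wpDl.
have [p Xp up] := dist_adherent u X_nonempty e1.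
have := fval_lipschitz (proj1 Xp) Yu; rewrite enormB => lip.
have := fval_feasible Xp; have := ler_wpM2l Mf0 (ltW up).
have : Mf * (e / (Mf + 1)) <= e.
  by rewrite mulrCA ger_pMr// ler_pdivrMr ?mul1r ?lerDl ?ltr_wpDl.
lra.
Qed.

Definition violation a u : R := fine (epos (g a) u).

Lemma violationE a u : Y u -> epos (g a) u = (violation a u)%:E.
Proof.
move=> Yu; rewrite fineK// ge0_fin_numE; last by rewrite le_max lexx orbT.
by rewrite gt_max ltry andbT; exact: g_dom Yu.
Qed.

Lemma violation_ge0 a u : 0 <= violation a u.
Proof. by rewrite fine_ge0// le_max lexx orbT. Qed.

Lemma violation_feasible a p : X p -> violation a p = 0.
Proof. by move=> [_ gp]; rewrite /violation /epos max_r. Qed.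

(** The algorithm uses subgradients of the positive part, while [g_bound] concerns those of [g a];
    [subdiff_epos] links the two. *)
Lemma violation_subdiff a u s : Y u -> 0 < violation a u ->
  subdiff (epos (g a)) u s ->
  enorm s <= Mg /\ forall y, Y y -> violation a u + dotv s (y - u) <= violation a y.
Proof.
move=> Yu u0 su; split; last first.
  by move=> y Yy; have := su y; rewrite !violationE// -EFinD lee_fin.
apply: (g_bound Yu); apply: subdiff_epos su => //; last exact: g_dom Yu.
by move: u0; rewrite -lte_fin -violationE// /epos lt_max ltxx orbF.
Qed.

Lemma violation_lipschitz a u y : Y u -> Y y ->
  violation a u - violation a y <= Mg * enorm (u - y).
Proof.
move=> Yu Yy.
have Mgpos : 0 < violation a u -> violation a u - violation a y <= Mg * enorm (u - y).
  move=> u0; have [s su] : subdiff (epos (g a)) u !=set0.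
    apply: g_subdiff => //.
    by move: u0; rewrite -lte_fin -violationE// /epos lt_max ltxx orbF.
  have [sM /(_ _ Yy)] := violation_subdiff Yu u0 su.
  rewrite -(opprB u y) dotvNr; have := dotv_le s (u - y).
  by have := ler_wpM2r (enorm_ge0 (u - y)) sM; lra.
have [/Mgpos//|u0] := ltP 0 (violation a u).
have := mulr_ge0 (ltW Mg_gt0) (enorm_ge0 (u - y)); have := violation_ge0 a y; lra.
Qed.

Lemma feasible_convex : convex_set (X : set (convex_lmodType 'rV[R]_n)).
Proof.
move=> u y t; rewrite !inE => -[Yu gu] [Yy gy]; split.
  by have := Y_convex t (mem_set Yu) (mem_set Yy); rewrite inE.
move=> a; have := convex_efunP (@g_convex a) (gu a) (gy a) (a := t%:num).
by rewrite !mulr0 addr0; apply; rewrite ge0 le1.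
Qed.

(** * The algorithm along a fixed sample path *)

Context {dO} {Omega : measurableType dO} (P : probability Omega R)
  (c beta q : R) (alpha : nat -> R) (N : nat)
  (om : nat -> nat -> Omega -> A) (x v : nat -> Omega -> 'rV[R]_n)
  (z d : nat -> nat -> Omega -> 'rV[R]_n)
  (Y_closed : closed Y)
  (N_ge1 : (1 <= N)%N) (run : seq_run Y sf g alpha beta N om x v z d)
  (beta_gt0 : 0 < beta) (beta_lt2 : beta < 2)
  (alphaE : forall k, alpha k = 4 / (mu * k.+1%:R)).

Lemma run_in_x k w : Y (x k w).
Proof.
case: run => init grad start step fin _ _ _ _.
have Y0 : Y !=set0 by exists (x 0%N w).
case: k => // k; rewrite fin//; case: N N_ge1 step => // M _ step.
by rewrite step ?leqnn//; exact: proj_in.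
Qed.

Lemma run_in_v k w : (1 <= k)%N -> Y (v k w).
Proof.
move=> k1; case: run => _ grad _ _ _ _ _ _ _.
by rewrite grad//; apply: proj_in => //; exists (x 0%N w); exact: run_in_x.
Qed.

Lemma run_in_z k i w : (1 <= k)%N -> (i <= N)%N -> Y (z k i w).
Proof.
move=> k1 iN; case: (run) => _ _ start step _ _ _ _ _.
case: i iN => [|i] iN; first by rewrite start//; exact: run_in_v.
by rewrite step//; apply: proj_in => //; exists (x 0%N w); exact: run_in_x.
Qed.

(** Decrease coefficient of one feasibility step; [q] is [kappa / c]. *)
Let kappa := beta * (2 - beta) / Mg ^+ 2.

Lemma kappa_gt0 : 0 < kappa.
Proof. by rewrite divr_gt0 ?mulr_gt0 ?subr_gt0 ?exprn_gt0. Qed.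

Lemma z_step k i w p : (1 <= k)%N -> (1 <= i <= N)%N -> X p ->
  enorm (z k i w - p) ^+ 2 <=
  enorm (z k i.-1 w - p) ^+ 2 - kappa * violation (om k i w) (z k i.-1 w) ^+ 2.
Proof.
move=> k1 iN Xp; have Yp := proj1 Xp.
case: (run) => _ _ _ step _ dpos _ _ _; rewrite step//.
rewrite -[fine _]/(violation (om k i w) (z k i.-1 w)).
have Yz : Y (z k i.-1 w).
  by apply: run_in_z => //; case/andP: iN => _; exact/leq_trans/leq_pred.
have [g0|] := ltP 0 (violation (om k i w) (z k i.-1 w)).
  have [|dM dsub] := violation_subdiff Yz g0 (dpos k i w k1 iN _).
    by rewrite violationE// lte_fin.
  apply: polyak_step => //; first by rewrite !ltW.
  have := dsub _ Yp; rewrite (violation_feasible _ Xp) -(opprB _ p) dotvNr; lra.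
rewrite le_eqVlt ltNge violation_ge0 orbF => /eqP ->.
rewrite mul0r mulr0 scale0r subr0 expr0n/= mulr0 subr0.
by rewrite ler_pXn2r ?nnegrE ?enorm_ge0//; exact: proj_contract.
Qed.

(* Only the first index of the minibatch is used to make progress. *)
Lemma x_step k w p : (1 <= k)%N -> X p ->
  enorm (x k w - p) ^+ 2 <=
  enorm (v k w - p) ^+ 2 - kappa * violation (om k 1%N w) (v k w) ^+ 2.
Proof.
move=> k1 Xp; case: (run) => _ _ start _ fin _ _ _ _; rewrite fin//.
suff H i : (i < N)%N -> enorm (z k i.+1 w - p) ^+ 2 <=
    enorm (v k w - p) ^+ 2 - kappa * violation (om k 1%N w) (v k w) ^+ 2.
  by have := H N.-1; rewrite prednK//; apply.
elim: i => [|i IHi] iN; first by rewrite -start//; exact: z_step.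
apply: le_trans (z_step _ _ _ Xp) _ => //.
rewrite lerBlDr (le_trans (IHi (ltnW iN)))// lerDl mulr_ge0 ?sqr_ge0//.
exact: ltW kappa_gt0.
Qed.

Lemma x_step_le k w p : (1 <= k)%N -> X p ->
  enorm (x k w - p) ^+ 2 <= enorm (v k w - p) ^+ 2.
Proof.
move=> k1 Xp; apply: le_trans (x_step w k1 Xp) _.
by rewrite gerDl oppr_le0 mulr_ge0 ?sqr_ge0// ltW// kappa_gt0.
Qed.

(** The decrease in [x_step] is the same for all feasible [p], so it survives the infimum over [p].
    A square root turns the bound into one on norms, to which [le_dist] applies. *)
Lemma dist_step k w : (1 <= k)%N ->
  dist (x k w) X ^+ 2 <=
  dist (v k w) X ^+ 2 - kappa * violation (om k 1%N w) (v k w) ^+ 2.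
Proof.
move=> k1; set G := violation _ _ ^+ 2.
have G0 : 0 <= kappa * G by rewrite mulr_ge0 ?sqr_ge0// ltW// kappa_gt0.
have s0 : 0 <= dist (x k w) X ^+ 2 + kappa * G by rewrite addr_ge0 ?sqr_ge0.
rewrite lerBrDr -(sqr_sqrtr s0) ler_pXn2r ?nnegrE ?sqrtr_ge0 ?dist_ge0//.
apply: le_dist => // p Xp.
rewrite -(ler_pXn2r (n := 2)) ?nnegrE ?sqrtr_ge0 ?enorm_ge0// sqr_sqrtr//.
rewrite -lerBrDr; apply: le_trans (x_step w k1 Xp).
by rewrite ler_pXn2r ?nnegrE ?dist_ge0 ?enorm_ge0// dist_le.
Qed.

(** The previous iterate lies in [Y], so projecting back moves the point by at most the step size
    times [Mf]; the step size used at iteration [k] is 4 / (mu k). *)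
Lemma dist_gradient_step k w : (1 <= k)%N ->
  dist (v k w) X <= dist (x k.-1 w) X + 4 * Mf / mu / k%:R.
Proof.
case: k => // k _; case: (run) => _ grad _ _ _ _ _ _ _.
have Yx := run_in_x k w.
have : enorm (v k.+1 w - x k w) <= 4 * Mf / mu / k.+1%:R.
  rewrite grad//=; apply: le_trans (proj_contract _ Y_closed Y_convex Yx) _.
  rewrite addrAC subrr add0r enormN enormZ alphaE ger0_norm; last first.
    by rewrite divr_ge0// mulr_ge0// ltW.
  rewrite [leRHS](_ : _ = 4 / (mu * k.+1%:R) * Mf); last first.
    by rewrite invfM; ring.
  by rewrite ler_wpM2l ?sf_bound// divr_ge0// mulr_ge0// ltW.
move=> /(le_trans (dist_lipschitz (v k.+1 w) (x k w) X_nonempty)).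
by rewrite lerBlDl.
Qed.

(* The weights (k+1)^2 of the average come from multiplying the one-step descent
   inequality by (k+1)^3, after which the squared distances telescope. *)
Lemma gap_step k w p : (1 <= k)%N -> X p -> fval p = fstar ->
  k.+1%:R ^+ 2 * (fval (x k w) - fstar) <=
  mu / 8 * (k%:R ^+ 3 * enorm (x k w - p) ^+ 2 -
            k.+1%:R ^+ 3 * enorm (x k.+1 w - p) ^+ 2) + 2 * Mf ^+ 2 / mu * k.+1%:R.
Proof.
move=> k1 Xp fp; have Yp := proj1 Xp; have Yx := run_in_x k w.
have := x_step_le w (isT : (1 <= k.+1)%N) Xp.
case: (run) => _ grad _ _ _ _ _ _ _; rewrite grad//= => H1.
have H2 := proj_gradient_step (alpha k) (x k w) Y_closed Y_convex Yp (sf_bound Yx).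
have H3 := fval_strong Yx Yp; rewrite fp (enormB p) -(opprB _ p) dotvNr in H3.
move: H1 H2 H3; rewrite alphaE.
set a := enorm (x k w - p) ^+ 2; set a' := enorm (x k.+1 w - p) ^+ 2.
set D := dotv _ _; set r := fval _; set m := k.+1%:R.
have m0 : 0 < m by rewrite ltr0n.
have a0 : 0 <= a by exact: sqr_ge0.
have -> : k%:R = m - 1 :> R by rewrite /m -natr1 addrK.
move=> H1 /(le_trans H1) {}H1 H3.
have w0 : 0 <= mu / 8 * m ^+ 3 by rewrite mulr_ge0 ?divr_ge0 ?exprn_ge0// ltW.
have := ler_wpM2l w0 H1; have := ler_wpM2l (sqr_ge0 m) H3.
have -> : mu / 8 * m ^+ 3 * (a - 2 * (4 / (mu * m)) * D + (4 / (mu * m)) ^+ 2 * Mf ^+ 2)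
    = mu / 8 * m ^+ 3 * a - m ^+ 2 * D + 2 * Mf ^+ 2 / mu * m.
  by field; rewrite !gt_eqF.
(* Strong convexity lowers the coefficient of [a] from m^3 to m^3 - 4 m^2, which is (m - 1)^3 - (m^2
   + 3 m - 1); the surplus is dropped. *)
have : 0 <= mu / 8 * (a * (m ^+ 2 + 3 * m - 1)).
  have m1 : 1 <= m by rewrite ler1n.
  have m2 := mulr_ge0 (ltW m0) (ltW m0).
  by rewrite mulr_ge0 ?divr_ge0 ?(ltW mu_gt0)// mulr_ge0//; lra.
set C := 2 * Mf ^+ 2 / mu * m; lra.
Qed.

Lemma gap_sum t w p : X p -> fval p = fstar ->
  \sum_(1 <= k < t.+1) k.+1%:R ^+ 2 * (fval (x k w) - fstar) <=
  mu / 8 * (enorm (x 1%N w - p) ^+ 2 - t.+1%:R ^+ 3 * enorm (x t.+1 w - p) ^+ 2) +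
  2 * Mf ^+ 2 / mu * \sum_(1 <= k < t.+1) k.+1%:R.
Proof.
move=> Xp fp; elim: t => [|t IHt].
  by rewrite !big_geq// expr1n mul1r subrr !mulr0 addr0.
rewrite [leLHS]big_nat_recr// [in leRHS]big_nat_recr// /=.
apply: le_trans (lerD IHt (gap_step w (isT : (1 <= t.+1)%N) Xp fp)) _.
by rewrite le_eqVlt; apply/orP; left; apply/eqP; ring.
Qed.

Lemma average_feasible t w : (0 < t)%N -> Y (average x t w).
Proof.
move=> t0; have [] := @average_convex R n Omega x Y (fun=> 0) w t Y_convex _ _ t0 => //.
- by move=> u y a _ _ _; rewrite !mulr0 addr0.
- by move=> k; exact: run_in_x.
Qed.

(** The initial distance term is at most Mf^2 / (2 mu), by the diameter bound, and is absorbed into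
    the sum of the k + 1, raising its coefficient from 2 to 3. The ratio of that sum to the total
    weight is at most 2 / t, hence the 6. *)
Lemma average_gap t w : (0 < t)%N ->
  fval (average x t w) - fstar <= 6 * Mf ^+ 2 / mu / t%:R.
Proof.
move=> t0; have [p [Xp fp]] := Xstar_nonempty.
have {}fp : fval p = fstar by rewrite /fval fp.
have [u y a Yu Yy a01|k|] := @average_convex R n Omega x Y
    (fun u => fval u - fstar) w t Y_convex _ _ t0.
- by have := fval_convex Yu Yy a01; lra.
- exact: run_in_x.
move=> _ /le_trans; apply; rewrite /=.
set S := avg_weight R t; have S0 : 0 < S by exact: avg_weight_gt0.
rewrite (eq_bigr (fun k => S^-1 * (k.+1%:R ^+ 2 * (fval (x k w) - fstar)))); last first.
  by move=> k _; rewrite mulrAC mulrC.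
rewrite -mulr_sumr.
have M0 : 0 <= Mf ^+ 2 / mu by rewrite divr_ge0 ?sqr_ge0// ltW.
have T1 : 1 <= \sum_(1 <= k < t.+1) k.+1%:R :> R.
  rewrite big_ltn// (le_trans (_ : 1 <= 2%:R))// ?ler1n// lerDl.
  by apply: sumr_ge0.
apply: (@le_trans _ _ (S^-1 * (3 * (Mf ^+ 2 / mu) * \sum_(1 <= k < t.+1) k.+1%:R))).
  rewrite ler_wpM2l ?invr_ge0 ?(ltW S0)//; apply: le_trans (gap_sum t w Xp fp) _.
  set T := \sum_(1 <= k < t.+1) k.+1%:R in T1 *.
  have : mu / 8 * enorm (x 1%N w - p) ^+ 2 <= Mf ^+ 2 / mu * 2^-1.
    apply: (@le_trans _ _ (mu / 8 * (2 * Mf / mu) ^+ 2)).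
      have D1 := diameter_le (run_in_x 1 w) (proj1 Xp).
      rewrite ler_wpM2l ?divr_ge0 ?(ltW mu_gt0)// ler_pXn2r ?nnegrE ?enorm_ge0//.
      exact: le_trans (enorm_ge0 _) D1.
    by rewrite le_eqVlt; apply/orP; left; apply/eqP; field; rewrite gt_eqF.
  have : 0 <= mu / 8 * (t.+1%:R ^+ 3 * enorm (x t.+1 w - p) ^+ 2).
    by rewrite !mulr_ge0 ?divr_ge0 ?(ltW mu_gt0)// ?exprn_ge0// enorm_ge0.
  have := ler_wpM2l M0 T1; rewrite -[2 * Mf ^+ 2 / mu]mulrA; lra.
have := ler_wpM2l (mulr_ge0 (ler0n _ 3) M0) (sumS_div_avg_weight t0).
rewrite -/S => H; rewrite (mulrC S^-1) -[leLHS]mulrA (le_trans H)// le_eqVlt.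
by apply/orP; left; apply/eqP; ring.
Qed.

Lemma average_abs_gap t w : (0 < t)%N ->
  (`|f (average x t w) - fstar%:E| <=
   (6 * Mf ^+ 2 / mu / t%:R + Mf * dist (average x t w) X)%:E)%E.
Proof.
move=> t0; have Ya := average_feasible w t0; rewrite fvalE// -EFinB abse_EFin lee_fin.
have M0 : 0 <= Mf by apply: le_trans (enorm_ge0 _) (sf_bound Ya).
have C0 : 0 <= 6 * Mf ^+ 2 / mu / t%:R.
  by rewrite !divr_ge0 ?mulr_ge0 ?sqr_ge0// ltW.
have D0 : 0 <= Mf * dist (average x t w) X by rewrite mulr_ge0// dist_ge0.
rewrite ler_norml; have := fval_lower Ya; have := average_gap w t0.
by move=> ? ?; apply/andP; split; lra.
Qed.

(** * Expected distance to the feasible set *)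

Context
  (g_measurable : forall u, Y u -> measurable_fun setT (fun a => g a u))
  (x0_measurable : vmeasurable measurable (x 0%N))
  (om_measurable : forall k i, (1 <= k)%N -> (1 <= i <= N)%N ->
     measurable_fun setT (om k i))
  (c_gt0 : 0 < c)
  (regularity : forall u k i, Y u -> (1 <= k)%N -> (1 <= i <= N)%N ->
     exists2 Z : Omega -> \bar R,
       is_cond_exp P (history (x 0%N) om N k.-1)
         (fun w => (epos (g (om k i w)) u ^+ 2)%E) Z
     & {ae P, forall w, ((dist u X ^+ 2)%:E <= c%:E * Z w)%E})
  (qE : q = beta * (2 - beta) / (c * Mg ^+ 2)) (q_lt1 : q < 1).

Lemma history_sub k : history (x 0%N) om N k `<=` measurable.
Proof.
apply: smallest_sub; first exact: sigma_algebra_measurable.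
move=> D [[j [B [mB ->]]]|[t [j [B [/andP[t1 _] jN mB ->]]]]]; first exact: x0_measurable.
by rewrite -[X in measurable X]setTI; exact: om_measurable.
Qed.

Lemma q_gt0 : 0 < q.
Proof. by rewrite qE divr_gt0 ?mulr_gt0 ?exprn_gt0// subr_gt0. Qed.

Let diam := 2 * Mf / mu.

Lemma diam_ge0 : 0 <= diam.
Proof.
have [p [Yp _]] := X_nonempty.
exact: le_trans (enorm_ge0 _) (diameter_le Yp Yp).
Qed.

Lemma dist_le_diam u : Y u -> dist u X <= diam.
Proof.
move=> Yu; have [p Xp] := X_nonempty.
exact: le_trans (dist_le u Xp) (diameter_le Yu (proj1 Xp)).
Qed.

Lemma coord_bound : exists B, forall u j, Y u -> `|u 0 j| <= B.
Proof.
have [p [Yp _]] := X_nonempty; exists (diam + enorm p) => u j Yu.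
rewrite (le_trans (ler_coord_enorm u j))// -{1}(subrK p u).
by rewrite (le_trans (ler_enormD _ _))// lerD2r diameter_le.
Qed.

Lemma dist_sqr_lipschitz y u : Y y -> Y u ->
  dist y X ^+ 2 - dist u X ^+ 2 <= 2 * diam * enorm (y - u).
Proof.
move=> Yy Yu; apply: ler_sqrB_bounded; rewrite ?dist_ge0 ?dist_le_diam ?enorm_ge0//.
exact: dist_lipschitz.
Qed.

Lemma bounded_rv_dist (u : Omega -> 'rV[R]_n) : vmeasurable measurable u ->
  (forall w, Y (u w)) ->
  bounded_rv (fun w => dist (u w) X) /\ bounded_rv (fun w => dist (u w) X ^+ 2).
Proof.
move=> mu' Yu; have [B uB] := coord_bound.
have md : measurable_fun setT (fun w => dist (u w) X).
  apply: (@measurable_lipschitz_comp R n _ Omega u Y B 1 (fun y => dist y X)) => //.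
  - by move=> w j; exact: uB.
  - by move=> y s _ _; rewrite mul1r dist_lipschitz.
split; split => //; [exists diam|exact: measurable_funX|exists (diam ^+ 2)] => w.
  by rewrite ger0_norm ?dist_ge0// dist_le_diam.
rewrite ger0_norm ?sqr_ge0// ler_pXn2r ?nnegrE ?dist_ge0 ?diam_ge0//.
exact: dist_le_diam.
Qed.

Lemma vmeasurable_x k : vmeasurable measurable (x k).
Proof.
case: k => // k j B mB; apply: history_sub  _ _.
by case: (run) => _ _ _ _ _ _ _ _ ax; exact: ax.
Qed.

Lemma vmeasurable_v k : (1 <= k)%N -> vmeasurable (history (x 0%N) om N k.-1) (v k).
Proof. by case: (run) => _ _ _ _ _ _ _ av _; exact: av. Qed.

Lemma violation_measurable k y : (1 <= k)%N -> Y y ->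
  measurable_fun setT (fun w => violation (om k 1%N w) y ^+ 2).
Proof.
move=> k1 Yy; apply: measurable_funX.
apply: (measurableT_comp (fine_measurable _)) => //.
apply: (measurable_maxe _ (measurable_cst _)).
apply: (measurableT_comp (g_measurable Yy)).
by apply: om_measurable.
Qed.

Lemma violation_le a u : Y u -> violation a u <= Mg * diam.
Proof.
move=> Yu; have [p Xp] := X_nonempty.
have := violation_lipschitz a Yu (proj1 Xp); rewrite (violation_feasible a Xp) subr0.
by move=> /le_trans; apply; rewrite ler_wpM2l ?(ltW Mg_gt0)// diameter_le//; case: Xp.
Qed.

(** The regularity assumption integrated over an event of the past, where the conditional
    expectation has the same integral as the squared violation. This is the form that [freezing]
    takes as input. *)
Lemma regularity_integral k y S : (1 <= k)%N -> Y y -> history (x 0%N) om N k.-1 S ->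
  ((dist y X ^+ 2)%:E * P S <=
   c%:E * \int[P]_(w in S) (violation (om k 1%N w) y ^+ 2)%:E)%E.
Proof.
move=> k1 Yy HS; have mS := history_sub HS.
have [Z [Z0 mZ intZ] aeZ] := regularity Yy k1 (N_ge1 : (1 <= 1 <= N)%N).
have mfZ : measurable_fun setT Z.
  by move=> _ B mB; rewrite setTI; apply: history_sub _ _; exact: mZ.
have -> : (\int[P]_(w in S) (violation (om k 1%N w) y ^+ 2)%:E = \int[P]_(w in S) Z w)%E.
  by rewrite intZ//; apply: eq_integral => w _; rewrite violationE.
rewrite -integral_cst// -ge0_integralZl_EFin//; last 2 first.
- exact: measurable_funTS.
- exact: ltW.
apply: ae_ge0_le_integral => //.
- by move=> w _; rewrite lee_fin sqr_ge0.
- by move=> w _; rewrite mule_ge0// lee_fin ltW.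
- by apply: measurable_funeM; exact: measurable_funTS.
- by apply: filterS aeZ => w Zw _.
Qed.

Local Notation E phi := (\int[P]_w (phi w : R)).

Lemma expected_contraction k : (1 <= k)%N ->
  E (fun w => dist (x k w) X ^+ 2) <= (1 - q) * E (fun w => dist (v k w) X ^+ 2).
Proof.
move=> k1.
have [_ bx] := bounded_rv_dist (vmeasurable_x k) (run_in_x k).
have mv : vmeasurable measurable (v k).
  by move=> j B mB; apply: history_sub _ _; exact: vmeasurable_v.
have [_ bv] := bounded_rv_dist mv (fun w => run_in_v w k1).
have kap := kappa_gt0.
have [B uB] := coord_bound.
(* By [dist_step], [psi] dominates the squared violation at the random point [v k]. *)
pose psi w := kappa^-1 * (dist (v k w) X ^+ 2 - dist (x k w) X ^+ 2).
have bpsi : bounded_rv psi by apply/bounded_rvZ/bounded_rvB.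
have psiE : E psi = kappa^-1 * (E (fun w => dist (v k w) X ^+ 2) -
                               E (fun w => dist (x k w) X ^+ 2)).
  rewrite RintegralZl//; last exact/bounded_rv_integrable/bounded_rvB.
  by rewrite RintegralB//; exact: bounded_rv_integrable.
have MgD : 0 <= Mg * diam by rewrite mulr_ge0 ?diam_ge0 ?ltW.
have : E (fun w => dist (v k w) X ^+ 2) <= c * E psi.
  apply: (@freezing R n _ Omega P _ (v k) Y (fun y => dist y X ^+ 2)
    (fun w y => violation (om k 1%N w) y ^+ 2) psi B (2 * diam)
    (2 * (Mg * diam) * Mg) c (@history_sub k.-1) (vmeasurable_v k1)) => //.
  - by move=> w j; apply: uB; exact: run_in_v.
  - by move=> w; exact: run_in_v.
  - by rewrite mulr_ge0// diam_ge0.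
  - exact: dist_sqr_lipschitz.
  - exact: (mulr_ge0 (mulr_ge0 (ler0n _ 2) MgD) (ltW Mg_gt0)).
  - move=> w y u Yy Yu; rewrite -(mulrA _ Mg); apply: ler_sqrB_bounded.
    + by rewrite violation_ge0 violation_le.
    + by rewrite violation_ge0 violation_le.
    + by rewrite mulr_ge0 ?enorm_ge0// ltW.
    + exact: violation_lipschitz.
  - by move=> w y; exact: sqr_ge0.
  - by move=> y Yy; exact: violation_measurable.
  - by move=> w; rewrite /psi mulrC ler_pdivlMr// mulrC lerBrDr addrC -lerBrDr dist_step.
  - exact: ltW.
  - by move=> y S Yy HS; exact: regularity_integral.
(* Since q c / kappa = 1, multiplying by [q] leaves exactly the difference of the two
   expectations. *)
rewrite psiE -(ler_pM2l q_gt0) [X in _ <= X](_ : _ =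
  E (fun w => dist (v k w) X ^+ 2) - E (fun w => dist (x k w) X ^+ 2)); last first.
  set D := _ - _; rewrite qE /kappa; field.
  by rewrite !gt_eqF// subr_gt0.
lra.
Qed.

(** Young's inequality with weight q / 2, chosen because (1 - q) (1 + q / 2) <= 1 - q / 2 keeps a
    contraction. *)
Lemma dist_sqr_step k w : (1 <= k)%N ->
  dist (v k w) X ^+ 2 <= (1 + q / 2) * dist (x k.-1 w) X ^+ 2 +
    (1 + 2 / q) * (4 * Mf / mu) ^+ 2 / k%:R ^+ 2.
Proof.
move=> k1; have := dist_gradient_step w k1; set s := _ / k%:R => H.
have D0 : 0 <= dist (v k w) X by exact: dist_ge0.
rewrite -mulrA -expr_div_n -/s.
have : dist (v k w) X ^+ 2 <= (dist (x k.-1 w) X + s) ^+ 2.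
  by rewrite ler_pXn2r ?nnegrE// (le_trans D0).
have : 0 <= (q / 2) * (dist (x k.-1 w) X - 2 / q * s) ^+ 2.
  by rewrite mulr_ge0 ?sqr_ge0// divr_ge0// ltW// q_gt0.
set a := dist (x _ _) _.
rewrite [X in 0 <= X](_ : _ = q / 2 * a ^+ 2 - 2 * a * s + 2 / q * s ^+ 2).
  lra.
by field; rewrite gt_eqF// q_gt0.
Qed.

Lemma expected_dist_rate :
  exists2 C, 0 <= C & forall k, E (fun w => dist (x k w) X) <= C / k.+1%:R.
Proof.
have q0 := q_gt0.
have bx k := bounded_rv_dist (vmeasurable_x k) (run_in_x k).
have b2 k : bounded_rv (fun w => dist (x k w) X ^+ 2) by case: (bx k).
pose L := (1 + 2 / q) * (4 * Mf / mu) ^+ 2.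
have L0 : 0 <= L by rewrite mulr_ge0 ?sqr_ge0// addr_ge0// divr_ge0// ltW.
have [|//|k|k k1|K K0 rate] := @inverse_square_rate R
    (fun k => E (fun w => dist (x k w) X ^+ 2)) (1 - q / 2) L (diam ^+ 2).
- rewrite subr_ge0 gtrBl divr_gt0// andbT ler_pdivrMr// mul1r.
  by rewrite (le_trans (ltW q_lt1))// ler1n.
- rewrite -[diam ^+ 2](_ : \int[P]_w (cst (diam ^+ 2) w) = _).
    apply: le_Rintegral => //; first exact: bounded_rv_integrable.
      exact: (bounded_rv_integrable _ _ (bounded_rv_cst _)).
    move=> w _; rewrite ler_pXn2r ?nnegrE ?dist_ge0 ?diam_ge0//.
    by apply: dist_le_diam; exact: run_in_x.
  by rewrite Rintegral_cst// (_ : fine (P setT) = 1) ?mulr1 ?probability_setT.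
- have mv : vmeasurable measurable (v k).
    by move=> j B mB; apply: history_sub; exact: vmeasurable_v.
  have [_ bv] := bounded_rv_dist mv (fun w => run_in_v w k1).
  have bL := @bounded_rv_cst R _ Omega (L / k%:R ^+ 2).
  have : E (fun w => dist (v k w) X ^+ 2) <=
      (1 + q / 2) * E (fun w => dist (x k.-1 w) X ^+ 2) + L / k%:R ^+ 2.
    rewrite -[X in _ + X](_ : \int[P]_w (cst (L / k%:R ^+ 2) w) = _); last first.
      by rewrite Rintegral_cst// (_ : fine (P setT) = 1) ?mulr1 ?probability_setT.
    rewrite -RintegralZl//; last exact: bounded_rv_integrable.
    rewrite -RintegralD//; last 2 first.
    - exact/bounded_rv_integrable/bounded_rvZ.
    - exact: (bounded_rv_integrable _ _ bL).
    apply: le_Rintegral => //.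
    - exact: bounded_rv_integrable.
    - by apply: bounded_rv_integrable => //; apply: bounded_rvD => //; exact: bounded_rvZ.
    - by move=> w _; exact: dist_sqr_step.
  have q1 : 0 <= 1 - q by rewrite subr_ge0 ltW.
  move=> /(ler_wpM2l q1) /(le_trans (expected_contraction k1)) /le_trans; apply.
  have : 0 <= q * (L / k%:R ^+ 2) by rewrite mulr_ge0 ?divr_ge0 ?sqr_ge0// ltW.
  have : 0 <= E (fun w => dist (x k.-1 w) X ^+ 2).
    by apply: Rintegral_ge0 => w _; exact: sqr_ge0.
  move=> /(mulr_ge0 (sqr_ge0 q)); set a := L / _; lra.
exists ((1 + K) / 2) => [|k]; first by rewrite divr_ge0// addr_ge0.
set s := k.+1%:R; have s0 : 0 < s by rewrite ltr0n.
have bs := @bounded_rv_cst R _ Omega (s^-1 / 2).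
(* From second to first moment: a <= s a^2 / 2 + 1 / (2 s), and s = k + 1 makes both terms of order
   1 / s. *)
apply: (@le_trans _ _ (s / 2 * E (fun w => dist (x k w) X ^+ 2) + s^-1 / 2)).
  rewrite -[X in _ + X](_ : \int[P]_w (cst (s^-1 / 2) w) = _); last first.
    by rewrite Rintegral_cst// (_ : fine (P setT) = 1) ?mulr1 ?probability_setT.
  rewrite -RintegralZl//; last exact: bounded_rv_integrable.
  rewrite -RintegralD//; last 2 first.
  - exact/bounded_rv_integrable/bounded_rvZ.
  - exact: (bounded_rv_integrable _ _ bs).
  apply: le_Rintegral => //.
  - by apply: bounded_rv_integrable => //; case: (bx k).
  - by apply: bounded_rv_integrable => //; apply: bounded_rvD => //; exact: bounded_rvZ.
  move=> w _; rewrite /=; set a := dist _ _.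
  have : 0 <= s / 2 * (a - s^-1) ^+ 2 by rewrite mulr_ge0 ?sqr_ge0// divr_ge0// ltW.
  rewrite [X in 0 <= X](_ : _ = s / 2 * a ^+ 2 - a + s^-1 / 2).
    by rewrite addrAC subr_ge0.
  by field; rewrite gt_eqF.
have s20 : 0 <= s / 2 by rewrite divr_ge0// ltW.
apply: le_trans (lerD (ler_wpM2l s20 (rate k)) (lexx _)) _.
by rewrite -/s le_eqVlt; apply/orP; left; apply/eqP; field; rewrite gt_eqF.
Qed.

Lemma average_dist t w : (0 < t)%N ->
  dist (average x t w) X <=
  \sum_(1 <= k < t.+1) k.+1%:R ^+ 2 / avg_weight R t * dist (x k w) X.
Proof.
move=> t0; have [u y a _ _ a01|k|//] := @average_convex R n Omega x Y
    (fun u => dist u X) w t Y_convex _ _ t0; last exact: run_in_x.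
by apply: dist_convex => //; exact: feasible_convex.
Qed.

Lemma average_dist_rate : exists2 C, 0 <= C & forall t, (0 < t)%N ->
  E (fun w => \sum_(1 <= k < t.+1) k.+1%:R ^+ 2 / avg_weight R t * dist (x k w) X) <=
  C / t%:R.
Proof.
have [C C0 rate] := expected_dist_rate; exists (C * 2) => [|t t0]; first exact: mulr_ge0.
have S0 : 0 < avg_weight R t := avg_weight_gt0 t0.
rewrite Rintegral_sum; last first.
  by move=> k; have [] := bounded_rv_dist (vmeasurable_x k) (run_in_x k).
rewrite -mulrA; apply: le_trans (ler_wpM2l C0 (sumS_div_avg_weight t0)).
rewrite mulr_suml mulr_sumr; apply: ler_sum => k _.
have w0 : 0 <= k.+1%:R ^+ 2 / avg_weight R t by rewrite divr_ge0 ?sqr_ge0// ltW.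
apply: le_trans (ler_wpM2l w0 (rate k)) _.
set m := k.+1%:R; have m0 : 0 < m by rewrite ltr0n.
by rewrite le_eqVlt; apply/orP; left; apply/eqP; field; rewrite !gt_eqF.
Qed.

Lemma average_rates : exists C, 0 < C /\ forall t, (0 < t)%N ->
  (\int[P]_w `|f (average x t w) - fstar%:E| <= (C / t%:R)%:E)%E /\
  (\int[P]_w (dist (average x t w) X)%:E <= (C / t%:R)%:E)%E.
Proof.
have [C C0 rate] := average_dist_rate.
have Mf0 : 0 <= Mf by have [p [Yp _]] := X_nonempty; exact: le_trans (enorm_ge0 _) (sf_bound Yp).
pose K := 6 * Mf ^+ 2 / mu; have K0 : 0 <= K by rewrite divr_ge0 ?mulr_ge0 ?sqr_ge0// ltW.
(* One positive constant that dominates both K + Mf C and [C]. *)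
exists (K + (Mf + 1) * (C + 1)); split.
  by rewrite ltr_wpDl// mulr_gt0// ltr_wpDl.
move=> t t0; have t0' : 0 < t%:R :> R by rewrite ltr0n.
(* A bounded random variable above [dist (average x t w) X], which takes its place under the
   integrals. *)
pose W w := \sum_(1 <= k < t.+1) k.+1%:R ^+ 2 / avg_weight R t * dist (x k w) X.
have bW : bounded_rv W.
  apply: bounded_rv_sum => k.
  by have [] := bounded_rv_dist (vmeasurable_x k) (run_in_x k).
have EW : E W <= C / t%:R := rate t t0.
have intE phi : bounded_rv phi -> (\int[P]_w (phi w)%:E)%E = (E phi)%:E.
  move=> bphi; rewrite /Rintegral fineK//.
  by apply: integrable_fin_num => //; exact: bounded_rv_integrable.
split.
  apply: (@le_trans _ _ (\int[P]_w (K / t%:R + Mf * W w)%:E)%E).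
    apply: le_integral_nonneg => w; first exact: abse_ge0.
    apply: le_trans (average_abs_gap w t0) _.
    by rewrite lee_fin lerD2l ler_wpM2l// average_dist.
  have bK := @bounded_rv_cst R _ Omega (K / t%:R).
  rewrite (intE (fun w => K / t%:R + Mf * W w)); last first.
    by apply: bounded_rvD => //; exact: bounded_rvZ.
  rewrite RintegralD//; last 2 first.
  - exact: (bounded_rv_integrable _ _ bK).
  - exact/bounded_rv_integrable/bounded_rvZ.
  rewrite Rintegral_cst// (_ : fine (P setT) = 1) ?mulr1 ?probability_setT//.
  rewrite RintegralZl//; last exact: bounded_rv_integrable.
  rewrite lee_fin.
  apply: le_trans (lerD (lexx _) (ler_wpM2l Mf0 EW)) _.
  by rewrite mulrA -mulrDl ler_pM2r ?invr_gt0// lerD2l; lra.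
apply: (@le_trans _ _ (\int[P]_w (W w)%:E)%E).
  apply: le_integral_nonneg => w; first by rewrite lee_fin dist_ge0.
  by rewrite lee_fin average_dist.
rewrite intE// lee_fin (le_trans EW)// ler_pM2r ?invr_gt0//.
by have := mulr_ge0 Mf0 C0; lra.
Qed.

End Problem.

(** * The rates with their dependence on [b] *)

Unset Implicit Arguments.

Theorem theorem3 (R : realType) (n : nat)
  (dA : measure_display) (A : measurableType dA) (PA : probability A R)
  (dO : measure_display) (Omega : measurableType dO) (P : probability Omega R)
  (Y : set 'rV[R]_n) (f : 'rV[R]_n -> \bar R) (g : A -> 'rV[R]_n -> \bar R)
  (fstar mu Mf Mg c beta q b : R) (alpha : nat -> R) (N : nat)
  (sf : 'rV[R]_n -> 'rV[R]_n)
  (om : nat -> nat -> Omega -> A)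
  (x v : nat -> Omega -> 'rV[R]_n) (z d : nat -> nat -> Omega -> 'rV[R]_n)
  (* the problem *)
  (f_convex : convex_efun f) (g_convex : forall a, convex_efun (g a))
  (f_dom : Y `<=` edom f) (g_dom : forall a, Y `<=` edom (g a))
  (fstarE : ereal_inf [set f u | u in feasible Y g] = fstar%:E)
  (* Assumption A *)
  (Y_closed : closed Y)
  (Y_convex : convex_set (Y : set (convex_lmodType 'rV[R]_n)))
  (X_nonempty : feasible Y g !=set0)
  (Xstar_nonempty : [set u | feasible Y g u /\ f u = fstar%:E] !=set0)
  (mu_gt0 : 0 < mu)
  (f_strong : forall u y s, Y u -> Y y -> subdiff f u s ->
     (f u + (dotv s (y - u))%:E + (mu / 2 * enorm (y - u) ^+ 2)%:E <= f y)%E)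
  (Mf_gt0 : 0 < Mf)
  (f_bound : forall u s, Y u -> subdiff f u s -> enorm s <= Mf)
  (Mg_gt0 : 0 < Mg)
  (g_bound : forall a u s, Y u -> subdiff (g a) u s -> enorm s <= Mg)
  (* the subgradients used by the algorithm exist *)
  (sf_subdiff : forall u, Y u -> subdiff f u (sf u))
  (g_subdiff : forall a u, Y u -> (0 < g a u)%E -> subdiff (epos (g a)) u !=set0)
  (* the random data *)
  (g_measurable : forall u, Y u -> measurable_fun setT (fun a => g a u))
  (x0_measurable : vmeasurable measurable (x 0%N))
  (om_measurable : forall k i, (1 <= k)%N -> (1 <= i <= N)%N ->
     measurable_fun setT (om k i))
  (om_law : forall k i, (1 <= k)%N -> (1 <= i <= N)%N ->
     forall B, measurable B -> P (om k i @^-1` B) = PA B)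
  (* the algorithm *)
  (N_ge1 : (1 <= N)%N)
  (run : seq_run Y sf g alpha beta N om x v z d)
  (* Assumption B *)
  (c_gt0 : 0 < c)
  (regularity : forall u k i, Y u -> (1 <= k)%N -> (1 <= i <= N)%N ->
     exists2 Z : Omega -> \bar R,
       is_cond_exp P (history (x 0%N) om N k.-1)
         (fun w => (epos (g (om k i w)) u ^+ 2)%E) Z
     & {ae P, forall w, ((dist u (feasible Y g) ^+ 2)%:E <= c%:E * Z w)%E})
  (* the stepsizes *)
  (beta_gt0 : 0 < beta) (beta_lt2 : beta < 2)
  (alphaE : forall k, alpha k = 4 / (mu * k.+1%:R))
  (qE : q = beta * (2 - beta) / (c * Mg ^+ 2)) (q_lt1 : q < 1)
  (bE : b = (1 - q) ^- N - 1) :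
  bigO_le (fun t => \int[P]_w `|f (average x t w) - fstar%:E|)%E
          (fun t => 1 / t%:R + 1 / (Num.sqrt b * t%:R)) /\
  bigO_le (fun t => \int[P]_w (dist (average x t w) (feasible Y g))%:E)%E
          (fun t => 1 / (Num.sqrt b * t%:R)).
Proof.
have q0 : 0 < q by rewrite qE divr_gt0 ?mulr_gt0 ?exprn_gt0 ?subr_gt0.
have b0 : 0 < b.
  rewrite bE subr_gt0 -exprVn exprn_egt1 -?lt0n// invf_gt1 ?subr_gt0//.
  by rewrite gtrBl.
have [C [C0 rates]] : exists C, 0 < C /\ forall t, (0 < t)%N ->
    (\int[P]_w `|f (average x t w) - fstar%:E| <= (C / t%:R)%:E)%E /\
    (\int[P]_w (dist (average x t w) (feasible Y g))%:E <= (C / t%:R)%:E)%E.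
  by eapply average_rates with (mu := mu) (Mg := Mg) (c := c); eassumption.
have sb : 0 < Num.sqrt b by rewrite sqrtr_gt0.
split.
  exists C, 1%N; split => // t t0; have [ft _] := rates t t0.
  apply: le_trans ft _; rewrite lee_fin ler_wpM2l ?(ltW C0)// mul1r lerDl.
  by rewrite divr_ge0// mulr_ge0// ltW.
(* The factor [Num.sqrt b] cancels the one in the denominator of the rate. *)
exists (C * Num.sqrt b), 1%N; split; first exact: mulr_gt0.
move=> t t0; have [_ dt] := rates t t0; apply: le_trans dt _.
by rewrite lee_fin mul1r invfM -mulrA mulVKf ?gt_eqF.
Qed.
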